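(* If a regular $n$ bubble complex in $\mathbb{R}^2$ has no empty chambers and has positive equal pressure regions, then every $k$-gon of the complex has at most $6$ sides, i.e. $k\le 6$. In addition, every $k$-gon that shares an edge with the exterior region has at most $5$ sides.
   Context: All graphs are finite, embedded in the plane $\mathbb{R}^2$, with every vertex of degree at least three. An embedded planar graph encloses areas $A_1,\dots,A_n$ if it separates the plane into $n+1$ regions (not necessarily connected), $n$ of which (the interior regions) have the finite areas $A_1,\dots,A_n$ respectively, the remaining one (the exterior region) having infinite area. An $n$ bubble complex is an embedded planar graph enclosing some $n$ positive areas. A half-variation of an $n$ bubble complex $\mathcal{B}$ is a continuous family $\{\mathcal{B}_t : t\in[0,\epsilon)\}$ of $n$ bubble complexes with $\mathcal{B}_0=\mathcal{B}$. An $n$ bubble complex is regular if: (1) it has finitely many vertices, edges and faces; (2) each edge has constant curvature (arc of a circle or line segment); (3) each vertex is trivalent; (4) edges meet at vertices at angles $2\pi/3$; (5) all edges separating a given pair of regions have the same (signed) curvature; (6) no half-variation preserving all the enclosed areas has negative initial derivative of length at $t=0$. In a regular complex the pressure of the exterior region is $0$, and the pressure of another region is the sum of the signed curvatures of the edges crossed by a path from the exterior to that region that meets the edges transversely in finitely many points; the sign of a crossing is positive if the crossed edge bulges toward the side the path is coming from. The complex has positive equal pressure regions if all interior regions have the same pressure and it is positive. An empty chamber is a bounded connected component of the exterior region. A $k$-gon is a connected component of an interior region (a face of the graph) that is enclosed by exactly $k$ edges. *)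

(* Defs.v *)
From HB Require Import structures.
From mathcomp Require Import all_boot all_order all_algebra.
From mathcomp Require Import all_classical all_reals all_analysis.
Set Implicit Arguments.
Unset Strict Implicit.
Unset Printing Implicit Defensive.
Import Order.TTheory GRing.Theory Num.Theory.
Import numFieldNormedType.Exports.
Local Open Scope classical_set_scope.
Local Open Scope ring_scope.

Section Plane.
Variable R : realType.

(* The plane is [R * R]. Its norm is the sup norm, which gives the right
   topology; lengths and angles below use the Euclidean inner product. *)
Definition dot (u v : R * R) : R := u.1 * v.1 + u.2 * v.2.
Definition edist (u v : R * R) : R := Num.sqrt (dot (u - v) (u - v)).

(* Only meaningful for unit vectors. *)
Definition angle (u v : R * R) : R := acos (dot u v).

Definition area (A : set (R * R)) : \bar R :=
  ((@lebesgue_measure R) \x (@lebesgue_measure R))%E A.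

Definition curve_length (a b : R) (g : R -> R * R) : \bar R :=
  ereal_sup [set (\sum_(0 <= i < size s)
                   edist (g (nth b (a :: s) i)) (g (nth b s i)))%:E
            | s in [set s | itv_partition a b s]].

(* Besides edges joining vertices (loops included), closed edges carrying no
   vertex are allowed, so that a circle is a one-bubble complex. *)
Record plane_graph := PlaneGraph {
  verts : seq (R * R);
  edge : finType;
  curve : edge -> R -> R * R;
  curve_continuous : forall e, {within `[0, 1], continuous (curve e)};
  curve_injective : forall e s t, 0 <= s -> s < t -> t <= 1 ->
    curve e s = curve e t -> s = 0 /\ t = 1;
  curve_ends : forall e,
    (curve e 0 \in verts /\ curve e 1 \in verts) \/
    (curve e 0 = curve e 1 /\ curve e 0 \notin verts);
  curve_inner : forall e s, 0 < s -> s < 1 -> curve e s \notin verts;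
  curve_disjoint : forall e e' s s', e != e' ->
    0 <= s <= 1 -> 0 <= s' <= 1 ->
    curve e s = curve e' s' -> curve e s \in verts;
  (* edge-ends: [(e, false)] is the start of [e] and [(e, true)] its end *)
  degree_ge3 : forall v, v \in verts ->
    (3 <= #|[pred d : edge * bool | curve d.1 (d.2)%:R == v]|)%N
}.

Definition edge_end (G : plane_graph) (d : edge G * bool) : R * R :=
  curve d.1 (d.2)%:R.

Definition degree (G : plane_graph) (v : R * R) : nat :=
  #|[pred d : edge G * bool | edge_end d == v]|.

Definition edge_set (G : plane_graph) (e : edge G) : set (R * R) :=
  curve e @` `[0, 1].

Definition support (G : plane_graph) : set (R * R) :=
  [set x | exists e : edge G, edge_set e x].

Definition is_face (G : plane_graph) (F : set (R * R)) : Prop :=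
  exists2 x, (~` support G) x & F = connected_component (~` support G) x.

Definition graph_length (G : plane_graph) : \bar R :=
  (\sum_(e : edge G) curve_length 0 1 (@curve G e))%E.

(* [Some i] indexes the interior regions, [None] the exterior one. *)
Record bubble_complex (n : nat) := BubbleComplex {
  graph :> plane_graph;
  region : option 'I_n -> set (R * R);
  region_disjoint : trivIset setT region;
  region_cover : \bigcup_i region i = ~` support graph;
  region_faces : forall i x, region i x ->
    connected_component (~` support graph) x `<=` region i;
  interior_area : forall i : 'I_n,
    (0 < area (region (Some i)) /\ area (region (Some i)) < +oo)%E;
  exterior_area : area (region None) = +oo%E
}.

Section Regular.
Variable n : nat.
Implicit Type B : bubble_complex n.

(* Continuity in [t]: the union of the edges varies continuously in the
   Hausdorff distance, and a point of a region stays in the region with the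
   same label for nearby parameters.  The combinatorial type may change. *)
Definition continuous_family (eps : R) (Bt : R -> bubble_complex n) : Prop :=
  forall t0, 0 <= t0 < eps ->
    (forall delta, 0 < delta ->
       \forall t \near within `[0, eps[ (nbhs t0),
         (forall x, support (Bt t0) x ->
            exists2 y, support (Bt t) y & ball x delta y) /\
         (forall y, support (Bt t) y ->
            exists2 x, support (Bt t0) x & ball x delta y)) /\
    (forall i x, region (Bt t0) i x ->
       \forall t \near within `[0, eps[ (nbhs t0), region (Bt t) i x).

Definition half_variation B (eps : R) (Bt : R -> bubble_complex n) : Prop :=
  [/\ 0 < eps, Bt 0 = B & continuous_family eps Bt].

Definition preserves_areas B (eps : R) (Bt : R -> bubble_complex n) : Prop :=
  forall t, 0 <= t < eps -> forall i : 'I_n,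
    area (region (Bt t) (Some i)) = area (region B (Some i)).

Definition initial_length_derivative (eps : R) (Bt : R -> bubble_complex n)
    (l : R) : Prop :=
  exists len : R -> R,
    (forall t, 0 <= t < eps -> graph_length (Bt t) = (len t)%:E) /\
    ((len t - len 0) / t @[t --> 0^'+] --> l).

(* The unit-speed curve with initial point [arc_start], initial direction
   [(cos arc_dir, sin arc_dir)], constant signed curvature [arc_curv] (positive
   when turning left) and length [arc_len]: a segment if the curvature is [0],
   an arc of circle otherwise. *)
Record arc := Arc {
  arc_start : R * R;
  arc_dir : R;
  arc_curv : R;
  arc_len : R
}.

Definition arc_point (A : arc) (s : R) : R * R :=
  let th := arc_dir A in
  let k := arc_curv A in
  if k == 0 then
    ((arc_start A).1 + s * cos th, (arc_start A).2 + s * sin th)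
  else
    ((arc_start A).1 + (sin (th + k * s) - sin th) / k,
     (arc_start A).2 + (cos th - cos (th + k * s)) / k).

Definition arc_tangent (A : arc) (s : R) : R * R :=
  (cos (arc_dir A + arc_curv A * s), sin (arc_dir A + arc_curv A * s)).

(* The unit normal on the left of the direction of travel. *)
Definition arc_normal (A : arc) (s : R) : R * R :=
  (- sin (arc_dir A + arc_curv A * s), cos (arc_dir A + arc_curv A * s)).

(* [A] parametrizes the edge [e], in the direction of [curve e] as soon as the
   two ends of [e] differ.  The bound on [arc_curv] says that a circle is
   traversed at most once.  On a closed edge without vertices the starting
   point of [A] is arbitrary. *)
Definition is_edge_arc B (e : edge B) (A : arc) : Prop :=
  [/\ 0 < arc_len A,
      `|arc_curv A| * arc_len A <= 2 * pi,
      edge_set e = arc_point A @` `[0, arc_len A] &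
      curve e 0 \in verts B ->
      arc_point A 0 = curve e 0 /\ arc_point A (arc_len A) = curve e 1].

(* Unit tangent pointing away from the end [b] of the arc. *)
Definition outgoing (A : arc) (b : bool) : R * R :=
  if b then - arc_tangent A (arc_len A) else arc_tangent A 0.

Definition region_on_left B (A : arc) (i : option 'I_n) : Prop :=
  forall s, 0 < s < arc_len A ->
    \forall h \near 0^'+, region B i (arc_point A s + h *: arc_normal A s).

Definition region_on_right B (A : arc) (i : option 'I_n) : Prop :=
  forall s, 0 < s < arc_len A ->
    \forall h \near 0^'+, region B i (arc_point A s - h *: arc_normal A s).

(* The edge [e] has region [i] on one side, region [j] on the other, and signed
   curvature [k], counted positively when [e] bulges toward [j]. *)
Definition separates B (e : edge B) (i j : option 'I_n) (k : R) : Prop :=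
  exists2 A, is_edge_arc e A &
    [/\ region_on_left B A i, region_on_right B A j & k = arc_curv A] \/
    [/\ region_on_left B A j, region_on_right B A i & k = - arc_curv A].

Record regular B : Prop := Regular {
  regular_finite : finite_set [set F | is_face B F];
  regular_curvature : forall e : edge B, exists A, is_edge_arc e A;
  regular_trivalent : forall v, v \in verts B -> degree B v = 3%N;
  regular_angles : forall (d d' : edge B * bool) A A',
    edge_end d \in verts B -> edge_end d = edge_end d' -> d != d' ->
    is_edge_arc d.1 A -> is_edge_arc d'.1 A' ->
    angle (outgoing A d.2) (outgoing A' d'.2) = 2 * pi / 3;
  regular_pressure : forall (e e' : edge B) i j k k', i != j ->
    separates e i j k -> separates e' i j k' -> k = k';
  regular_stationary : forall eps Bt l,
    half_variation B eps Bt -> preserves_areas B eps Bt ->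
    initial_length_derivative eps Bt l -> ~ (l < 0)
}.

(* At time [t] the path [g] crosses an edge transversely at an interior point
   of that edge, with signed curvature [k]: a left-turning arc (positive
   [arc_curv]) bulges to its right, so crossing it from right to left counts
   positively. *)
Definition crosses B (g : R -> R * R) (t k : R) : Prop :=
  exists (e : edge B) A s v,
    [/\ is_edge_arc e A, 0 < s < arc_len A, g t = arc_point A s,
        is_derive t 1 g v &
        dot v (arc_normal A s) != 0 /\
        k = Num.sg (dot v (arc_normal A s)) * arc_curv A].

(* [q] is the sum of the signed curvatures of the edges crossed by some
   admissible path from the exterior region to region [i]. *)
Definition crossing_sum B (i : option 'I_n) (q : R) : Prop :=
  exists (g : R -> R * R) (ts : seq R) (k : R -> R),
    [/\ {within `[0, 1], continuous g},
        region B None (g 0) /\ region B i (g 1),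
        uniq ts /\ (forall t, t \in ts <-> 0 <= t <= 1 /\ support B (g t)),
        (forall t, t \in ts -> crosses B g t (k t)) &
        q = \sum_(t <- ts) k t].

(* The sum does not depend on the path: [p] is the pressure of region [i] when
   it is the only value obtained. *)
Definition is_pressure B (i : option 'I_n) (p : R) : Prop :=
  match i with
  | None => p = 0
  | Some _ => crossing_sum B i = [set p]
  end.

Definition positive_equal_pressure B : Prop :=
  exists2 p, 0 < p & forall i : 'I_n, is_pressure B (Some i) p.

Definition empty_chamber B (C : set (R * R)) : Prop :=
  (exists2 x, region B None x & C = connected_component (region B None) x) /\
  bounded_set C.

Definition bounds B (e : edge B) (F : set (R * R)) : Prop :=
  edge_set e `<=` closure F.

Definition kgon B (k : nat) (F : set (R * R)) : Prop :=
  (exists (i : 'I_n) x, region B (Some i) x /\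
     F = connected_component (region B (Some i)) x) /\
  #|[pred e : edge B | `[< bounds e F >]]| = k.

Definition shares_edge_with_exterior B (F : set (R * R)) : Prop :=
  exists e : edge B, bounds e F /\ bounds e (region B None).

End Regular.
End Plane.

(* Main.v *)
Require Import Defs.
From mathcomp Require Import all_boot all_order all_algebra.
From mathcomp Require Import all_classical all_reals all_analysis.
From mathcomp Require Import ring lra.
Import Defs.
Set Implicit Arguments.
Unset Strict Implicit.
Unset Printing Implicit Defensive.
Import Order.TTheory GRing.Theory Num.Theory.
Import numFieldNormedType.Exports.
Local Open Scope classical_set_scope.
Local Open Scope ring_scope.

(* Crossing an edge changes the pressure by its signed curvature, so an edge
   between two interior regions is straight and an edge between an interior and
   the exterior region bulges toward the exterior. Together with the angles
   2 pi / 3 this makes every interior face F locally convex along its boundary,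
   hence convex: when the segments from a point of F sweep a triangle, the first
   one to leave F would touch the graph in an impossible way. At each vertex of
   the graph in the closure of F, the face fills exactly one of the three sectors
   of angle 2 pi / 3, so that such a corner has a normal cone of angle pi / 3 and
   carries at most two edge-ends of F. Normal cones of distinct corners are
   disjoint, so of the six directions of a generic regular hexagon each corner
   owns at least one: there are at most six corners, and at most as many edges.
   If F shares an edge with the exterior, this edge is curved and a direction
   normal to it belongs to no corner, which leaves five. *)

(** * Points and segments of the plane *)

Section Points.
Variable R : realType.
Implicit Types (p q u v w : R * R) (A : set (R * R)).

(** Regions are mere open sets here, and nothing describes the boundary of a face as a closed curve
    along which turning angles could be added up. Convexity replaces this: once a face is known to
    be convex, its corners can be counted by maximizing linear functionals. The six is 2 pi divided
    by the exterior angle pi - 2 pi / 3 of a corner. Sides are compared with corners through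
    edge-ends: a side has two, a corner absorbs at most two, so a loop needs no special case. An
    edge without vertices escapes this count and is treated apart: it is a full circle and the only
    side of its face. The pressure is known only through paths that meet the graph transversely in
    finitely many points. To read off the curvature at one point, a straight line through it is
    followed from the exterior, its slope avoiding finitely many values; comparing the sums just
    before and just after the point isolates one term. Convexity uses only the weak sign of the
    curvature seen from an interior region; that a side shared with the exterior is really curved is
    a separate argument, based on [0 < P]. *)

Definition cross u v : R := u.1 * v.2 - u.2 * v.1.

Lemma pointP p q : p.1 = q.1 -> p.2 = q.2 -> p = q.
Proof. by case: p q => a b [c d] /= -> ->. Qed.

Lemma ler_unit_norm (t a : R) : 0 <= t <= 1 -> `|t * a| <= `|a|.
Proof. by case/andP=> t0 t1; rewrite normrM ger0_norm // ler_piMl. Qed.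

Lemma basis_decomp d w u : cross d w != 0 ->
  u = (cross u w / cross d w) *: d + (cross d u / cross d w) *: w.
Proof.
rewrite /cross => h; apply: pointP => /=; rewrite /GRing.scale /=; by field.
Qed.

Lemma basis_vanish d w u : cross d w != 0 -> cross d u = 0 -> cross u w = 0 ->
  u = 0.
Proof.
by move=> h h1 h2; rewrite (basis_decomp u h) h1 h2 !mul0r !scale0r addr0.
Qed.

Lemma open_boxP A p : open A -> A p -> exists2 e : R, 0 < e &
  forall q, `|q.1 - p.1| < e -> `|q.2 - p.2| < e -> A q.
Proof.
move=> oA Ap; have /nbhs_ballP[e /= e0 he] : nbhs p A by exact: open_nbhs_nbhs.
exists e => // q h1 h2; apply: he.
by split; rewrite /ball /= distrC.
Qed.

Lemma open_boxI A : (forall p, A p -> exists2 e : R, 0 < e &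
  forall q, `|q.1 - p.1| < e -> `|q.2 - p.2| < e -> A q) -> open A.
Proof.
move=> h; rewrite openE => p /h[e e0 he]; apply/nbhs_ballP; exists e => //.
by move=> q [/= h1 h2]; apply: he; rewrite distrC.
Qed.

Lemma closure_boxP A p : closure A p <-> forall e : R, 0 < e ->
  exists2 q, A q & `|q.1 - p.1| < e /\ `|q.2 - p.2| < e.
Proof.
split=> [cA e e0|h U /nbhs_ballP[e /= e0 he]].
  have [q [Aq [/= h1 h2]]] := cA _ (nbhsx_ballx p _ e0).
  by exists q => //; split; rewrite distrC.
have [q Aq [h1 h2]] := h _ e0; exists q; split=> //; apply: he.
by split; rewrite /ball /= distrC.
Qed.

Definition segment p q : set (R * R) :=
  [set r | exists2 t : R, 0 <= t <= 1 & r = p + t *: (q - p)].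

Lemma segment_l p q : segment p q p.
Proof. by exists 0; rewrite ?scale0r ?addr0 // lexx ler01. Qed.

Lemma segment_r p q : segment p q q.
Proof. by exists 1; rewrite ?ler01 ?lexx // scale1r addrC subrK. Qed.

Lemma line_continuous p v : continuous (fun t : R => p + t *: v).
Proof.
move=> t; apply: cvgD; first exact: cvg_cst.
by apply: cvgZr_tmp; exact: cvg_id.
Qed.

Lemma segment_connected p q : connected (segment p q).
Proof.
have -> : segment p q = (fun t : R => p + t *: (q - p)) @` `[0, 1].
  apply/seteqP; split=> r /=.
    by case=> t ht ->; exists t => //=; rewrite in_itv.
  by case=> t; rewrite in_itv /= => ht <-; exists t.
apply: connected_continuous_connected; first exact: segment_connected.
by apply: continuous_subspaceT => t; exact: line_continuous.
Qed.

Lemma component_segment A x p q : connected_component A x p ->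
  segment p q `<=` A -> connected_component A x q.
Proof.
move=> Ap sA; apply: (connected_component_trans Ap).
have := connected_component_max (segment_l p q) sA (@segment_connected p q).
by apply; exact: segment_r.
Qed.

Lemma component_open A x : open A -> open (connected_component A x).
Proof.
move=> oA; apply: open_boxI => p Ap.
have [e e0 he] := open_boxP oA (connected_component_sub Ap).
exists e => // q h1 h2; apply: (component_segment Ap) => r [t t01 ->].
apply: he => /=; rewrite /GRing.scale /= addrC addKr.
  exact: le_lt_trans (ler_unit_norm _ t01) h1.
exact: le_lt_trans (ler_unit_norm _ t01) h2.
Qed.

End Points.

(** * Convex open sets and their tangent directions *)

Section Convex.
Variable R : realType.
Implicit Types (p q u v w D : R * R) (A E F : set (R * R)).

Definition segment_convex A := forall p q, A p -> A q -> segment p q `<=` A.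

Lemma segmentE p q (t : R) : 0 <= t <= 1 -> segment p q (p + t *: (q - p)).
Proof. by move=> h; exists t. Qed.

(** If [y] is replaced by a nearby [y'] of [F] and [f] is moved by [((1 - t) / t) *: (y - y')], the
    combination with weights [1 - t] and [t] does not change, and the moved [f] is still in [F]. *)
Lemma convex_closure_open F f y (t : R) : open F -> segment_convex F ->
  F f -> closure F y -> 0 < t <= 1 -> F (y + t *: (f - y)).
Proof.
move=> oF cF Ff cy /andP[t0 t1].
have [e e0 he] := open_boxP oF Ff.
have te0 : 0 < t * e by exact: mulr_gt0.
have [y' Fy' [h1 h2]] := (closure_boxP F y).1 cy _ te0.
pose f' : R * R := f + ((1 - t) / t) *: (y - y').
have bnd (a b : R) : `|a - b| < t * e -> `|(1 - t) / t * (b - a)| < e.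
  move=> h; rewrite normrM ger0_norm; last by apply: divr_ge0; lra.
  rewrite distrC mulrAC ltr_pdivrMr // mulrC [e * t]mulrC.
  apply: le_lt_trans h; rewrite ler_piMr //; lra.
have Ff' : F f'.
  by apply: he; rewrite /f' /= /GRing.scale /= addrC addKr; exact: bnd.
have -> : y + t *: (f - y) = y' + t *: (f' - y').
  by apply: pointP; rewrite /f' /= /GRing.scale /=; field; lra.
by apply: (cF _ _ Fy' Ff'); apply: segmentE; lra.
Qed.

(** [E] contains a point [q + h *: D + o(h)] for every small [h > 0]. No parametrization is
    involved, so ends and inner points of an edge, in both directions of travel, are treated
    alike. *)
Definition tangent_dir E q D := forall e : R, 0 < e -> exists2 d : R, 0 < d &
  forall h, 0 < h < d ->
    exists r : R * R, [/\ `|r.1| < e, `|r.2| < e & E (q + h *: (D + r))].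

(** A box of [F] around [v + h *: D] shrinks under homotheties of centre [v] to boxes that stay in
    [F] by convexity; these would catch the points of [E] leaving [v] in direction [D]. *)
Lemma tangent_avoid F E v D (h : R) : open F -> segment_convex F ->
  closure F v -> (forall x, E x -> ~ F x) -> tangent_dir E v D -> 0 < h ->
  ~ F (v + h *: D).
Proof.
move=> oF cF cv EF tD h0 Fh.
have [e e0 he] := open_boxP oF Fh.
have eh0 : 0 < e / h by exact: divr_gt0.
have [d d0 hd] := tD _ eh0.
pose h' := Num.min (d / 2) h.
have h'0 : 0 < h' by rewrite lt_min h0 andbT; lra.
have h'h : h' <= h by rewrite ge_min lexx orbT.
have h'd : h' <= d / 2 by rewrite ge_min lexx.
have [|r [r1 r2 Er]] := hd h'; first by apply/andP; split=> //; lra.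
have Fr : F (v + h *: (D + r)).
  apply: he; rewrite /= /GRing.scale /=.
    have -> : v.1 + h * (D.1 + r.1) - (v.1 + h * D.1) = h * r.1 by ring.
    by rewrite normrM gtr0_norm // mulrC -ltr_pdivlMr.
  have -> : v.2 + h * (D.2 + r.2) - (v.2 + h * D.2) = h * r.2 by ring.
  by rewrite normrM gtr0_norm // mulrC -ltr_pdivlMr.
apply: (EF _ Er).
have -> : v + h' *: (D + r) = v + (h' / h) *: ((v + h *: (D + r)) - v).
  by apply: pointP; rewrite /= /GRing.scale /=; field; lra.
apply: convex_closure_open => //.
by rewrite divr_gt0 //= ler_pdivrMr // mul1r.
Qed.

(** The segment from the given point of the sector to a point with [x <= 0] meets the line of [D2]
    at some coordinate [ys]: on the ray of [D2], at [v], or beyond [v], and in the last case it has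
    met the ray of [D1] before. The second coordinate is treated by exchanging the two
    directions. *)
Lemma sector_pair F v D1 D2 (a b : R) : segment_convex F ->
  cross D1 D2 != 0 -> 0 < a -> 0 < b -> F (v + a *: D1 + b *: D2) -> ~ F v ->
  (forall h, 0 < h -> ~ F (v + h *: D1)) ->
  (forall h, 0 < h -> ~ F (v + h *: D2)) ->
  forall f, F f -> exists x y : R, [/\ 0 < x, 0 < y & f = v + x *: D1 + y *: D2].
Proof.
move=> cF; have half (E1 E2 : R * R) (a' b' x y : R) : 0 < a' -> 0 < b' ->
    F (v + a' *: E1 + b' *: E2) -> ~ F v ->
    (forall h, 0 < h -> ~ F (v + h *: E1)) ->
    (forall h, 0 < h -> ~ F (v + h *: E2)) ->
    F (v + x *: E1 + y *: E2) -> 0 < x.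
  move=> a0 b0 Fab Fv n1 n2 Fxy; rewrite ltNge; apply/negP => x0.
  pose t := a' / (a' - x); pose ys := b' + t * (y - b').
  have t01 : 0 <= t <= 1.
    by rewrite /t divr_ge0 /= ?ler_pdivrMr; lra.
  have Fs : F (v + ys *: E2).
    have -> : v + ys *: E2 = (v + a' *: E1 + b' *: E2) +
        t *: ((v + x *: E1 + y *: E2) - (v + a' *: E1 + b' *: E2)).
      by apply: pointP; rewrite /ys /t /= /GRing.scale /=; field; lra.
    by apply: (cF _ _ Fab Fxy); exact: segmentE.
  have [y0|y0|y0] := ltgtP ys 0.
  - pose s := b' / (b' - ys).
    have s0 : 0 <= s by rewrite divr_ge0 //; lra.
    have s1 : s < 1 by rewrite /s ltr_pdivrMr; lra.
    apply: (n1 (a' * (1 - s))); first by apply: mulr_gt0 => //; lra.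
    have -> : v + (a' * (1 - s)) *: E1 = (v + a' *: E1 + b' *: E2) +
        s *: ((v + ys *: E2) - (v + a' *: E1 + b' *: E2)).
      have hs : s * (b' - ys) = b' by rewrite /s divfK //; lra.
      apply: pointP; rewrite /= /GRing.scale /=.
        transitivity (v.1 + a' * (1 - s) * E1.1 + (b' - s * (b' - ys)) * E2.1).
          by rewrite hs; ring.
        ring.
      transitivity (v.2 + a' * (1 - s) * E1.2 + (b' - s * (b' - ys)) * E2.2).
        by rewrite hs; ring.
      ring.
    by apply: (cF _ _ Fab Fs); apply: segmentE; lra.
  - exact: (n2 ys).
  - by apply: Fv; move: Fs; rewrite y0 scale0r addr0.
move=> c0 a0 b0 Fab Fv n1 n2 f Ff.
pose x := cross (f - v) D2 / cross D1 D2; pose y := cross D1 (f - v) / cross D1 D2.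
have fE : f = v + x *: D1 + y *: D2.
  by rewrite -addrA -basis_decomp // addrC subrK.
exists x, y; split=> //; rewrite fE in Ff.
  exact: half Fab Fv n1 n2 Ff.
rewrite addrAC in Fab; rewrite addrAC in Ff.
exact: half Fab Fv n2 n1 Ff.
Qed.

Definition in_sector F v D1 D2 := forall f, F f ->
  exists x y : R, [/\ 0 < x, 0 < y & f = v + x *: D1 + y *: D2].

(** As [D1 + D2 + D3 = 0], the three rays cut the plane into three open sectors. The point [f] is on
    no ray, hence in one sector, and [sector_pair] brings all of [F] there. *)
Lemma sector_trichotomy F v D1 D2 D3 f : segment_convex F ->
  cross D1 D2 != 0 -> D1 + D2 + D3 = 0 -> F f -> ~ F v ->
  (forall h, 0 < h -> ~ F (v + h *: D1)) ->
  (forall h, 0 < h -> ~ F (v + h *: D2)) ->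
  (forall h, 0 < h -> ~ F (v + h *: D3)) ->
  [\/ in_sector F v D1 D2, in_sector F v D2 D3 | in_sector F v D3 D1].
Proof.
move=> cF c0 D0 Ff Fv n1 n2 n3.
have D3E : D3 = - D1 - D2 by rewrite -[LHS](addKr (D1 + D2)) D0 addr0 opprD.
have c23 : cross D2 D3 != 0.
  by rewrite (_ : cross D2 D3 = cross D1 D2) // D3E /cross /=; ring.
have c31 : cross D3 D1 != 0.
  by rewrite (_ : cross D3 D1 = cross D1 D2) // D3E /cross /=; ring.
pose x := cross (f - v) D2 / cross D1 D2; pose y := cross D1 (f - v) / cross D1 D2.
have fE : f = v + x *: D1 + y *: D2.
  by rewrite -addrA -basis_decomp // addrC subrK.
have f23 : f = v + (y - x) *: D2 + (- x) *: D3.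
  by rewrite fE D3E; apply: pointP; rewrite /= /GRing.scale /=; ring.
have f31 : f = v + (- y) *: D3 + (x - y) *: D1.
  by rewrite fE D3E; apply: pointP; rewrite /= /GRing.scale /=; ring.
have [/andP[x0 y0]|n12] := boolP ((0 < x) && (0 < y)).
  by apply: Or31; apply: (sector_pair cF c0 x0 y0 _ Fv) => //; rewrite -fE.
have [/andP[]|n23'] := boolP ((0 < y - x) && (0 < - x)) => [h1 h2|].
  by apply: Or32; apply: (sector_pair cF c23 h1 h2 _ Fv) => //; rewrite -f23.
have [/andP[]|n31'] := boolP ((0 < - y) && (0 < x - y)) => [h1 h2|].
  by apply: Or33; apply: (sector_pair cF c31 h1 h2 _ Fv) => //; rewrite -f31.
exfalso; have [x0|x0|x0] := ltgtP x 0.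
- have xy : y = x by move: n12 n23' n31'; lra.
  apply: (n3 (- x)); first by lra.
  by move: Ff; rewrite f23 xy subrr scale0r addr0.
- have y0 : y = 0 by move: n12 n23' n31'; lra.
  by apply: (n1 x) => //; move: Ff; rewrite fE y0 scale0r addr0.
- have [y0|y0] : y = 0 \/ 0 < y by move: n12 n23' n31'; lra.
    by apply: Fv; move: Ff; rewrite fE x0 y0 !scale0r !addr0.
  by apply: (n2 y) => //; move: Ff; rewrite fE x0 scale0r addr0.
Qed.
End Convex.

(** * Corners of angle 2 pi / 3 *)

Section Hexagon.
Variable R : realType.
Implicit Types (p q u v w D : R * R) (C : set (R * R)).

Lemma dotDr u v w : dot u (v + w) = dot u v + dot u w.
Proof. by rewrite /dot /=; ring. Qed.

Lemma dotZr u v (a : R) : dot u (a *: v) = a * dot u v.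
Proof. by rewrite /dot /= /GRing.scale /=; ring. Qed.

Lemma dotC u v : dot u v = dot v u.
Proof. by rewrite /dot mulrC [u.2 * _]mulrC. Qed.

Definition rot120 u : R * R :=
  (- (u.1 / 2) - Num.sqrt 3 / 2 * u.2, Num.sqrt 3 / 2 * u.1 - u.2 / 2).

Lemma sqr_sqrt3 : Num.sqrt 3 ^+ 2 = 3 :> R.
Proof. by rewrite sqr_sqrtr. Qed.

Lemma rot_sum u : u + rot120 u + rot120 (rot120 u) = 0.
Proof.
apply: pointP; rewrite /rot120 /=.
  transitivity ((3 - Num.sqrt 3 ^+ 2) / 4 * u.1); first by field.
  by rewrite sqr_sqrt3 subrr !mul0r.
transitivity ((3 - Num.sqrt 3 ^+ 2) / 4 * u.2); first by field.
by rewrite sqr_sqrt3 subrr !mul0r.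
Qed.

Lemma rot3 u : rot120 (rot120 (rot120 u)) = u.
Proof.
apply/eqP; rewrite -(inj_eq (addrI (rot120 u + rot120 (rot120 u)))) rot_sum.
by rewrite addrC addrA rot_sum.
Qed.

Lemma rot_eq0 u : (rot120 u == 0) = (u == 0).
Proof.
have r0 : rot120 0 = 0 by apply: pointP; rewrite /rot120 /=; ring.
by apply/eqP/eqP => [h|->//]; rewrite -(rot3 u) h !r0.
Qed.

(** The square of [cross D D'] is [1 - 1 / 4], and the unit vector [D] together with [dot D D'] and
    [cross D D'] determines [D']; the sign of the cross product gives the two cases. *)
Lemma rot_pair D D' : dot D D = 1 -> dot D' D' = 1 -> dot D D' = - (1 / 2) ->
  D' = rot120 D \/ D = rot120 D'.
Proof.
move=> h1 h2 h3.
have hc : (cross D D' - Num.sqrt 3 / 2) * (cross D D' + Num.sqrt 3 / 2) = 0.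
  have -> : (cross D D' - Num.sqrt 3 / 2) * (cross D D' + Num.sqrt 3 / 2) =
    dot D D * dot D' D' - dot D D' ^+ 2 - (Num.sqrt 3) ^+ 2 / 4.
    by rewrite /cross /dot; field.
  by rewrite h1 h2 h3 sqr_sqrt3; field.
have coord (A B : R * R) : dot A A = 1 ->
    B = (dot A B * A.1 - cross A B * A.2, dot A B * A.2 + cross A B * A.1).
  move=> hA; apply: pointP => /=.
    by rewrite -[LHS]mul1r -hA /dot /cross; ring.
  by rewrite -[LHS]mul1r -hA /dot /cross; ring.
move/eqP: hc; rewrite mulf_eq0 subr_eq0 addr_eq0 => /orP[|] /eqP hc.
  left; rewrite (coord D D' h1) h3 hc /rot120.
  by apply: pointP => /=; field.
right; rewrite (coord D' D h2) (dotC D') h3.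
have -> : cross D' D = - cross D D' by rewrite /cross; ring.
by rewrite hc /rot120; apply: pointP => /=; field.
Qed.

Definition corner C v D := forall x, C x ->
  exists a b : R, [/\ 0 <= a, 0 <= b & x = v + a *: D + b *: rot120 D].

(** Rotating [w] amounts to rotating [u] backwards: these are the inner products of [w] with the six
    vertices of a regular hexagon containing [u]. *)
Definition hexdir u (c : bool * 'I_3) w : R :=
  (-1) ^+ c.1 * dot u (iter c.2 rot120 w).

Lemma hexdirD u c v w : hexdir u c (v + w) = hexdir u c v + hexdir u c w.
Proof.
have rD (a b : R * R) : rot120 (a + b) = rot120 a + rot120 b.
  by apply: pointP; rewrite /rot120 /=; ring.
have rI k : iter k rot120 (v + w) = iter k rot120 v + iter k rot120 w.
  by elim: k => //= k ->.
by rewrite /hexdir rI dotDr mulrDr.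
Qed.

Lemma hexdirZ u c (a : R) w : hexdir u c (a *: w) = a * hexdir u c w.
Proof.
have rZ (b : R * R) : rot120 (a *: b) = a *: rot120 b.
  by apply: pointP; rewrite /rot120 /= /GRing.scale /=; ring.
have rI k : iter k rot120 (a *: w) = a *: iter k rot120 w.
  by elim: k => //= k ->.
by rewrite /hexdir rI dotZr mulrCA.
Qed.

(** None of the six directions is on the boundary of the normal cone of a corner spanned by [D] and
    [rot120 D]. *)
Definition hexgeneric u D :=
  [/\ dot u D != 0, dot u (rot120 D) != 0 & dot u (rot120 (rot120 D)) != 0].

(** Of three nonzero numbers two have the same sign, and any two of them are consecutive in the
    cyclic order of [D], [rot120 D], [rot120 (rot120 D)]; the sign in [hexdir] then makes both
    negative. *)
Lemma hexdir_exists u D : hexgeneric u D ->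
  exists c, hexdir u c D < 0 /\ hexdir u c (rot120 D) < 0.
Proof.
case=> n0 n1 n2.
have s0 : dot u D + dot u (rot120 D) + dot u (rot120 (rot120 D)) = 0.
  by rewrite -!dotDr rot_sum /dot /=; ring.
pose o1 : 'I_3 := @Ordinal 3 1 isT; pose o2 : 'I_3 := @Ordinal 3 2 isT.
have hex (i : 'I_3) : 0 < dot u (iter i rot120 D) * dot u (iter i.+1 rot120 D) ->
    exists c, hexdir u c D < 0 /\ hexdir u c (rot120 D) < 0.
  move=> h; have [h1|h1] := ltP 0 (dot u (iter i rot120 D)).
    exists (true, i); rewrite /hexdir /= -iterSr expr1 !mulN1r !oppr_lt0.
    by move: h; rewrite pmulr_rgt0.
  have h2 : dot u (iter i rot120 D) < 0.
    rewrite lt_neqAle h1 andbT; apply: contraTneq h => ->.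
    by rewrite mul0r ltxx.
  exists (false, i); rewrite /hexdir /= -iterSr expr0 !mul1r.
  by move: h; rewrite nmulr_rgt0.
have := hex ord0; have := hex o1; have := hex o2; rewrite /= rot3.
move: n0 n1 n2 s0; set a := dot u D; set b := dot u (rot120 D); set c := dot u (rot120 (rot120 D)).
move=> n0 n1 n2 s0 h2 h1 h0.
have [/h0//|ab] := ltP 0 (a * b); have [/h1//|bc] := ltP 0 (b * c).
have [/h2//|ca] := ltP 0 (c * a).
have := mulf_neq0 n0 n1; nra.
Qed.

Lemma corner_strict C v D u c x : corner C v D ->
  hexdir u c D < 0 -> hexdir u c (rot120 D) < 0 -> C x -> x != v ->
  hexdir u c x < hexdir u c v.
Proof.
move=> cC h1 h2 /cC[a [b [a0 b0 xE]]] xv.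
rewrite xE !hexdirD !hexdirZ.
suff : 0 < a \/ 0 < b by case=> ?; nra.
apply/orP.
apply: contraNT xv; rewrite negb_or -!leNgt => /andP[a0' b0'].
rewrite xE.
have -> : a = 0 by apply/eqP; rewrite eq_le a0' a0.
have -> : b = 0 by apply/eqP; rewrite eq_le b0' b0.
by rewrite !scale0r !addr0.
Qed.

(* Each corner maximizes strictly one of the six functionals [hexdir u c]. *)
Lemma corner_count C (V : seq (R * R)) (Dir : R * R -> R * R) u :
  uniq V -> (forall v, v \in V -> [/\ C v, corner C v (Dir v) & hexgeneric u (Dir v)]) ->
  (size V <= 6)%N /\
  (forall q, C q -> q \notin V -> (forall x, C x -> dot u x <= dot u q) ->
     (size V <= 5)%N).
Proof.
move=> uV hV.
have /choice[f hf] : forall v, exists c, v \in V ->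
    hexdir u c (Dir v) < 0 /\ hexdir u c (rot120 (Dir v)) < 0.
  move=> v; have [vV|] := boolP (v \in V); last by exists (true, ord0).
  by have [_ _ /hexdir_exists[c hc]] := hV _ vV; exists c.
have strict v x : v \in V -> C x -> x != v -> hexdir u (f v) x < hexdir u (f v) v.
  move=> vV Cx xv; have [_ hc _] := hV _ vV; have [h1 h2] := hf _ vV.
  exact: (corner_strict hc).
have uf : uniq (map f V).
  rewrite map_inj_in_uniq // => v w vV wV fvw; apply/eqP/negPn/negP => vw.
  have [Cv _ _] := hV _ vV; have [Cw _ _] := hV _ wV.
  have := strict _ _ vV Cw; rewrite eq_sym => /(_ vw) h1.
  have := strict _ _ wV Cv vw; rewrite -fvw => h2.
  by have := lt_trans h1 h2; rewrite ltxx.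
rewrite -(size_map f V) -(card_uniqP uf); split.
  by apply: leq_trans (max_card _) _; rewrite card_prod card_bool card_ord.
move=> q Cq qV hq.
(* The index [(false, ord0)] is the functional [dot u] itself. Being maximal at a point that is no
   corner, it has no corner as strict maximum, and five indices remain. *)
have : (#|mem (map f V)| <= #|predC1 (false, ord0 : 'I_3)|)%N.
  apply: subset_leq_card; apply/fintype.subsetP => c /mapP[v vV ->].
  rewrite !inE; apply/negP => /eqP fv.
  have [Cv _ _] := hV _ vV.
  have := strict _ _ vV Cq; rewrite fv /hexdir /= !expr0 !mul1r => h.
  have := hq _ Cv; rewrite leNgt h //.
  by apply: contraNneq qV => ->.
by rewrite cardC1 card_prod card_bool card_ord.
Qed.

End Hexagon.

(** * Arcs *)

Section Arcs.
Variable R : realType.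
Implicit Types (p q : R * R) (A : arc R) (s t h k : R).

(** Tangential and normal coordinates of the point reached after length [h] on a curve of curvature
    [k]; the values for [k = 0] are the limits. *)
Definition arc_sin k h : R := if k == 0 then h else sin (k * h) / k.
Definition arc_cos k h : R := if k == 0 then 0 else (1 - cos (k * h)) / k.

Lemma arc_point_expand A s h : arc_point A (s + h) =
  arc_point A s + arc_sin (arc_curv A) h *: arc_tangent A s
                + arc_cos (arc_curv A) h *: arc_normal A s.
Proof.
rewrite /arc_point /arc_sin /arc_cos /arc_tangent /arc_normal.
case: eqP => [->|/eqP k0].
  by apply: pointP; rewrite /= /GRing.scale /= mul0r addr0; ring.
have -> : arc_dir A + arc_curv A * (s + h) =
  (arc_dir A + arc_curv A * s) + arc_curv A * h by ring.
move: (arc_dir A + arc_curv A * s) => ph.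
by apply: pointP; rewrite /= /GRing.scale /= ?sinD ?cosD; field.
Qed.

Lemma dot_tangent A s : dot (arc_tangent A s) (arc_tangent A s) = 1.
Proof. by rewrite /dot /= -!expr2 cos2Dsin2. Qed.

Lemma dot_normal A s : dot (arc_normal A s) (arc_normal A s) = 1.
Proof. by rewrite /dot /= mulrNN -!expr2 addrC cos2Dsin2. Qed.

Lemma dot_tangent_normal A s : dot (arc_tangent A s) (arc_normal A s) = 0.
Proof. by rewrite /dot /=; ring. Qed.

Lemma cross_tangent_normal A s : cross (arc_tangent A s) (arc_normal A s) = 1.
Proof. by rewrite /cross /= mulrN opprK -!expr2 cos2Dsin2. Qed.

Lemma frame_decomp A s q : q = dot q (arc_tangent A s) *: arc_tangent A s
                              + dot q (arc_normal A s) *: arc_normal A s.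
Proof.
have h := cos2Dsin2 (arc_dir A + arc_curv A * s).
apply: pointP; rewrite /dot /= /GRing.scale /=; move: h;
  set c := cos _; set d := sin _ => h.
  by rewrite -[LHS]mulr1 -h; ring.
by rewrite -[LHS]mulr1 -h; ring.
Qed.

Lemma derive_at0 (f : R -> R) (c : R) : is_derive (0 : R) 1 f c -> f 0 = 0 ->
  forall e : R, 0 < e -> exists2 d : R, 0 < d &
    forall h, `|h| < d -> `|f h - c * h| <= e * `|h|.
Proof.
move=> df f0 e e0.
have /derivable_nbhs : derivable f (0 : R) 1 by exact: ex_derive.
have := @ex_derive _ _ _ _ _ _ _ df; rewrite /derivable.
have <- : 'D_1 f 0 = c by exact: derive_val.
rewrite /derive => /cvg_ex[/= l hl]; rewrite (cvg_lim _ hl) // => _.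
move/cvgrPdist_le : hl => /(_ _ e0).
rewrite /dnbhs /prop_near1 /within /= => /nbhs_ballP[d /= d0 hd]; exists d => // h hh.
have [->|h0] := eqVneq h 0; first by rewrite f0 mulr0 subr0 normr0 mulr0.
have := hd h; rewrite /ball /= sub0r normrN => /(_ hh h0).
rewrite /GRing.scale /= mulr1 addr0 f0 subr0 => hl.
have -> : f h - l * h = - ((l - h^-1 * f h) * h) by field.
by rewrite normrN normrM ler_wpM2r.
Qed.

Lemma arc_small k (e : R) : 0 < e -> exists2 d : R, 0 < d &
  forall h, `|h| < d -> `|arc_sin k h - h| <= e * `|h| /\
                        `|arc_cos k h| <= e * `|h|.
Proof.
move=> e0; rewrite /arc_sin /arc_cos; case: eqP => [_|/eqP k0].
  by exists 1 => // h _; rewrite subrr normr0 mulr_ge0 // ltW.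
have ds : is_derive (0 : R) 1 sin 1.
  by rewrite -[X in is_derive _ _ _ X](@cos0 R); exact: is_derive_sin.
have dc : is_derive (0 : R) 1 (cst 1 - cos) 0.
  have := is_deriveB (is_derive_cst (1 : R) (0 : R) 1) (is_derive_cos (0 : R)).
  by rewrite sin0 oppr0 subr0.
have [d1 d10 h1] := derive_at0 ds (sin0 R) e0.
have c0 : (cst 1 - cos) 0 = 0 :> R by change (1 - cos 0 = 0 :> R); rewrite cos0 subrr.
have [d2 d20 h2] := derive_at0 dc c0 e0.
have nk : 0 < `|k| by rewrite normr_gt0.
exists (Num.min d1 d2 / `|k|); first by rewrite divr_gt0 // lt_min d10.
move=> h; rewrite ltr_pdivlMr // mulrC -normrM lt_min => /andP[hd1 hd2].
have := h1 _ hd1; rewrite mul1r normrM => b.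
have : `|1 - cos (k * h) - 0 * (k * h)| <= e * `|k * h| := h2 _ hd2.
rewrite mul0r subr0 normrM => a.
split; last by rewrite normrM normfV ler_pdivrMr // -mulrA [`|h| * _]mulrC.
have -> : sin (k * h) / k - h = (sin (k * h) - k * h) / k by field.
by rewrite normrM normfV ler_pdivrMr // -mulrA [`|h| * _]mulrC.
Qed.

Lemma arc_tangent_dir A s (g : R) (E : set (R * R)) (d : R) :
  g = 1 \/ g = -1 -> 0 < d ->
  (forall h, 0 < h < d -> E (arc_point A (s + g * h))) ->
  tangent_dir E (arc_point A s) (g *: arc_tangent A s).
Proof.
move=> hg d0 hE e e0.
have e4 : 0 < e / 4 by lra.
have [d' d'0 hd'] := arc_small (arc_curv A) e4.
exists (Num.min d d'); first by rewrite lt_min d0.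
move=> h /andP[h0]; rewrite lt_min => /andP[hd1 hd2].
have ng : `|g * h| = h.
  by rewrite normrM (gtr0_norm h0); case: hg => ->; rewrite ?normrN normr1 mul1r.
have [] := hd' (g * h); rewrite ng // => b1 b2.
set S := arc_sin _ _ in b1; set C := arc_cos _ _ in b2.
exists (((S - g * h) / h) *: arc_tangent A s + (C / h) *: arc_normal A s).
have bnd (x y : R) : `|x| <= 1 -> `|y| <= 1 ->
    `|(S - g * h) / h * x + C / h * y| < e.
  move=> hx hy; apply: le_lt_trans (ler_normD _ _) _.
  have u1 : `|(S - g * h) / h * x| <= e / 4.
    rewrite normrM; apply: le_trans (ler_piMr _ hx) _ => //.
    by rewrite normrM normfV (gtr0_norm h0) ler_pdivrMr.
  have u2 : `|C / h * y| <= e / 4.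
    rewrite normrM; apply: le_trans (ler_piMr _ hy) _ => //.
    by rewrite normrM normfV (gtr0_norm h0) ler_pdivrMr.
  lra.
split.
- by rewrite /= /GRing.scale /=; apply: bnd; rewrite ?normrN ?cos_max ?sin_max.
- by rewrite /= /GRing.scale /=; apply: bnd; rewrite ?normrN ?cos_max ?sin_max.
have := hE h; rewrite h0 hd1 arc_point_expand => /(_ isT).
congr E; rewrite -/S -/C.
by apply: pointP; rewrite /= /GRing.scale /=; field; lra.
Qed.

Lemma cos_eq1 (x : R) : `|x| < 2 * pi -> cos x = 1 -> x = 0.
Proof.
move=> hx cx; apply/eqP/negPn/negP => x0.
have : sin (`|x| / 2) = 0.
  have : cos ((`|x| / 2) *+ 2) = 1 by rewrite -mulr_natr divfK ?cos_norm.
  rewrite cos_mulr2n cos2sin2 => h.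
  by apply/eqP; rewrite -sqrf_eq0; apply/eqP; move: h; rewrite mulr2n; lra.
have : 0 < sin (`|x| / 2).
  have n0 : 0 < `|x| by rewrite normr_gt0.
  by apply: sin_gt0_pi; apply/andP; split; lra.
by move=> /[swap] ->; rewrite ltxx.
Qed.

Lemma arc_sincos0 k h : `|k| * `|h| < 2 * pi ->
  arc_sin k h = 0 -> arc_cos k h = 0 -> h = 0.
Proof.
rewrite /arc_sin /arc_cos; case: eqP => [//|/eqP k0] hk _.
move/eqP; rewrite mulf_eq0 invr_eq0 (negbTE k0) orbF subr_eq0 eq_sym.
move/eqP/cos_eq1; rewrite normrM => /(_ hk)/eqP.
by rewrite mulf_eq0 (negbTE k0) => /eqP.
Qed.

Lemma arc_point_inj A s t : `|arc_curv A| * `|t - s| < 2 * pi ->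
  arc_point A s = arc_point A t -> s = t.
Proof.
move=> hk hst.
set T := arc_tangent A s; set N := arc_normal A s.
have h0 : arc_sin (arc_curv A) (t - s) *: T + arc_cos (arc_curv A) (t - s) *: N = 0.
  apply: (addrI (arc_point A s)).
  by rewrite addr0 addrA -arc_point_expand subrKC.
have hT : dot T T = 1 := dot_tangent A s.
have hN : dot N N = 1 := dot_normal A s.
have hTN : dot T N = 0 := dot_tangent_normal A s.
have h1 : arc_sin (arc_curv A) (t - s) = 0.
  have : dot T (0 : R * R) = 0 by rewrite /dot /=; ring.
  by rewrite -h0 dotDr !dotZr hT hTN mulr0 addr0 mulr1.
have h2 : arc_cos (arc_curv A) (t - s) = 0.
  have : dot N (0 : R * R) = 0 by rewrite /dot /=; ring.
  by rewrite -h0 dotDr !dotZr hN (dotC N) hTN mulr0 add0r mulr1.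
by have := arc_sincos0 hk h1 h2; lra.
Qed.

Definition arc_center A : R * R := arc_point A 0 + (arc_curv A)^-1 *: arc_normal A 0.

Lemma arc_point_center A s : arc_curv A != 0 ->
  arc_point A s = arc_center A - (arc_curv A)^-1 *: arc_normal A s.
Proof.
move=> k0; rewrite /arc_center /arc_point (negbTE k0) /arc_normal.
by apply: pointP; rewrite /= /GRing.scale /= mulr0 addr0; field.
Qed.

(** On a full circle this only changes the starting point, the length being kept. *)
Definition arc_shift A s : arc R :=
  Arc (arc_point A s) (arc_dir A + arc_curv A * s) (arc_curv A) (arc_len A).

Lemma arc_shift_point A s h : arc_point (arc_shift A s) h = arc_point A (s + h).
Proof.
have e0 : arc_point (arc_shift A s) 0 = arc_point A s.
  rewrite /arc_shift {1}/arc_point /=.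
  by case: eqP => k0; apply: pointP; rewrite /= ?mulr0 ?addr0 ?subrr; ring.
rewrite -[h in LHS]add0r !arc_point_expand e0.
by rewrite /arc_tangent /arc_normal /= mulr0 addr0.
Qed.

Lemma arc_period A s t : `|arc_curv A| * t = 2 * pi ->
  arc_point A (s + t) = arc_point A s.
Proof.
move=> ht; have cp : cos (`|arc_curv A| * t) = 1.
  by rewrite ht mulrC mulr_natr cos2pi.
have sp : sin (`|arc_curv A| * t) = 0 by rewrite ht mulrC mulr_natr sin2pi.
have [cp' sp'] : cos (arc_curv A * t) = 1 /\ sin (arc_curv A * t) = 0.
  case: (ger0P (arc_curv A)) cp sp => [//|_]; rewrite mulNr cosN sinN.
  by move=> -> /eqP; rewrite oppr_eq0 => /eqP.
rewrite arc_point_expand /arc_sin /arc_cos; case: eqP => [k0|_].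
  by exfalso; move: ht; rewrite k0 normr0 mul0r => h; have := pi_gt0 R; lra.
by rewrite cp' sp' subrr !mul0r !scale0r !addr0.
Qed.

End Arcs.

(** * Plane graphs *)

Section Topology.
Variable R : realType.

Lemma open_measurable_plane (U : set (R * R)) : open U ->
  measurable (U : set (measurableTypeR R * measurableTypeR R)).
Proof.
move=> oU.
pose box (c : (rat * rat) * (rat * rat)) : set (R * R) :=
  `](ratr c.1.1 : R), ratr c.1.2[ `*` `](ratr c.2.1 : R), ratr c.2.2[.
pose D := [set c | box c `<=` U].
have -> : U = \bigcup_(c in D) box c.
  apply/seteqP; split=> [p Up|p [c Dc /Dc]//].
  have [e e0 he] := open_boxP oU Up.
  have [a1] := @rat_in_itvoo R (p.1 - e) p.1 ltac:(lra).
  have [b1] := @rat_in_itvoo R p.1 (p.1 + e) ltac:(lra).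
  have [a2] := @rat_in_itvoo R (p.2 - e) p.2 ltac:(lra).
  have [b2] := @rat_in_itvoo R p.2 (p.2 + e) ltac:(lra).
  rewrite !in_itv /= => /andP[h1 h2] /andP[h3 h4] /andP[h5 h6] /andP[h7 h8].
  exists ((a1, b1), (a2, b2)); last first.
    by split; rewrite /= in_itv /=; apply/andP; split.
  move=> q [] /=; rewrite !in_itv /= => /andP[u1 u2] /andP[u3 u4].
  by apply: he; rewrite ltr_norml; apply/andP; split; lra.
rewrite bigcup_mkcond; apply: countable_bigcupT_measurable => [|c].
  exact: countableP.
case: ifP => _; last exact: measurable0.
by apply: measurableX; exact: measurable_itv.
Qed.

Lemma area_box (M : R) (A : set (R * R)) : open A ->
  (forall x, A x -> `|x.1| <= M /\ `|x.2| <= M) -> (area A < +oo)%E.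
Proof.
move=> oA hA; pose I : set R := `[- M, M]%classic.
have mI : measurable I by exact: measurable_itv.
apply: (@le_lt_trans _ _ (area (I `*` I))).
  apply: le_measure; rewrite ?inE.
  - exact: open_measurable_plane.
  - exact: measurableX.
  by move=> x /hA[h1 h2]; split; rewrite /I /= in_itv /= -ler_norml.
have fI : (lebesgue_measure I < +oo)%E.
  by rewrite /I lebesgue_measure_itv /=; case: ifP => _; rewrite ltry.
rewrite /area product_measure1E //; apply: lte_mul_pinfty => //.
by rewrite ge0_fin_numE.
Qed.

Section Graph.
Variable G : plane_graph R.
Implicit Types (e : edge G).

Lemma edge_set_compact e : compact (edge_set e).
Proof.
apply: continuous_compact; last exact: segment_compact.
exact: curve_continuous.
Qed.

Lemma edge_set_closed e : closed (edge_set e).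
Proof.
by apply: compact_closed; [exact: norm_hausdorff | exact: edge_set_compact].
Qed.

Lemma support_closed : closed (support G).
Proof.
have -> : support G = \bigcup_(e in [set: edge G]) edge_set e.
  by apply/seteqP; split=> x [e]; [exists e | move=> _; exists e].
apply: closed_bigcup => [|e _]; last exact: edge_set_closed.
exact: finite_finset.
Qed.

Lemma support_bounded : exists M : R, forall x, support G x ->
  `|x.1| <= M /\ `|x.2| <= M.
Proof.
have /choice[M hM] : forall e : edge G, exists M : R, 0 <= M /\
    forall x, edge_set e x -> `|x| <= M.
  move=> e; have [M [_ hM]] := compact_bounded (@edge_set_compact e).
  exists (Num.max M 0 + 1); split.
    by rewrite addr_ge0 // le_max lexx orbT.
  move=> x ex; apply: hM => //.
  by rewrite ltr_pwDr // le_max lexx.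
exists (\sum_e M e) => x [e ex].
have hx : `|x| <= \sum_e M e.
  rewrite (bigD1 e) //=; apply: le_trans ((hM e).2 _ ex) _.
  by rewrite lerDl; apply: sumr_ge0 => e' _; exact: (hM e').1.
by apply/andP; rewrite -ge_max.
Qed.

End Graph.

Lemma arc_point_continuous (A : arc R) : continuous (arc_point A).
Proof.
move=> s; rewrite /continuous_at /arc_point /=; case: (arc_curv A == 0).
  have lin (a b : R) : (a + x * b) @[x --> (s : R)] --> a + s * b.
    by apply: cvgD; [exact: cvg_cst | apply: cvgM; [exact: cvg_id | exact: cvg_cst]].
  exact: cvg_pair (lin _ _) (lin _ _).
have lin : (arc_dir A + arc_curv A * x) @[x --> (s : R)] --> arc_dir A + arc_curv A * s.
  by apply: cvgD; [exact: cvg_cst | apply: cvgM; [exact: cvg_cst | exact: cvg_id]].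
have aff (f : R -> R) (a b c : R) : f x @[x --> (s : R)] --> f s ->
    (a + (b + f x) / c) @[x --> (s : R)] --> a + (b + f s) / c.
  move=> hf; apply: cvgD; first exact: cvg_cst.
  by apply: cvgM; [apply: cvgD => //; exact: cvg_cst | exact: cvg_cst].
have hs : sin (arc_dir A + arc_curv A * x) @[x --> (s : R)] -->
    sin (arc_dir A + arc_curv A * s).
  by apply: (cvg_comp _ _ lin); exact: continuous_sin.
have hc : - cos (arc_dir A + arc_curv A * x) @[x --> (s : R)] -->
    - cos (arc_dir A + arc_curv A * s).
  by apply: cvgN; apply: (cvg_comp _ _ lin); exact: continuous_cos.
have := cvg_pair (aff _ (arc_start A).1 (- sin (arc_dir A)) (arc_curv A) hs)
                 (aff _ (arc_start A).2 (cos (arc_dir A)) (arc_curv A) hc).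
rewrite [X in _ + X / _]addrC.
under eq_fun do rewrite [X in _ + X / _]addrC.
exact.
Qed.

(** * Edges without vertices are full circles *)

Section Complex.
Variables (n : nat) (B : bubble_complex R n).
Implicit Types (e : edge B) (A : arc R).

Lemma arc_image_closed A (a b : R) : closed (arc_point A @` `[a, b]).
Proof.
apply: compact_closed; first exact: norm_hausdorff.
apply: continuous_compact; last exact: segment_compact.
by apply: continuous_subspaceT => s; exact: arc_point_continuous.
Qed.

(* An arc that is not a full circle is disconnected by removing an inner
   point, whereas a simple closed curve is not. *)
Lemma closed_edge_circle e A : is_edge_arc e A -> curve e 0 \notin verts B ->
  `|arc_curv A| * arc_len A = 2 * pi.
Proof.
case=> l0 hk eA _ nv.
have e01 : curve e 0 = curve e 1.
  by case: (curve_ends e) => [[h _]|[]//]; rewrite h in nv.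
apply/eqP; rewrite eq_le hk /= leNgt; apply/negP => hlt.
set l := arc_len A in l0 hk eA hlt.
have inj s t : 0 <= s <= l -> 0 <= t <= l -> arc_point A s = arc_point A t -> s = t.
  move=> hs ht; apply: arc_point_inj; apply: le_lt_trans hlt.
  by apply: ler_wpM2l => //; rewrite ler_norml; lra.
(* The removed point must differ from [curve e 0], so that its parameter [t0] on the curve is
   strictly between 0 and 1; as the arc is injective, [l / 3] or [l / 2] will do. *)
have [s sl sz] : exists2 s, 0 < s < l & arc_point A s != curve e 0.
  have [h|h] := eqVneq (arc_point A (l / 3)) (curve e 0); last first.
    by exists (l / 3) => //; lra.
  exists (l / 2); first by lra.
  rewrite -h; apply/negP => /eqP /inj hl.
  by have := hl ltac:(lra) ltac:(lra); lra.
have Es : edge_set e (arc_point A s).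
  by rewrite eA; exists s => //=; rewrite in_itv /=; lra.
have [t0] := Es; rewrite /= in_itv /= => ht0 et0.
have t0i : 0 < t0 < 1.
  rewrite !lt_neqAle; apply/andP; split; apply/andP; split; try by case/andP: ht0.
    by apply: contra_neq sz => h; rewrite -et0 -h.
  by apply: contra_neq sz => h; rewrite -et0 h e01.
pose I1 : set R := `[0, t0[%classic; pose I2 : set R := `]t0, 1]%classic.
pose E := (curve e @` I1) `|` (curve e @` I2).
(* Both remaining pieces of the curve contain the base point [curve e 0 = curve e 1]. *)
have cE : connected E.
  apply: connectedU.
  - exists (curve e 0); split.
      by exists 0 => //; rewrite /I1 /= in_itv /=; lra.
    by exists 1; [rewrite /I2 /= in_itv /=; lra | rewrite e01].
  - apply: connected_continuous_connected.
      by apply/connected_intervalP; exact: interval_is_interval.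
    apply: (continuous_subspaceW _ (@curve_continuous _ _ e)) => x.
    by rewrite /I1 /= !in_itv /=; lra.
  - apply: connected_continuous_connected.
      by apply/connected_intervalP; exact: interval_is_interval.
    apply: (continuous_subspaceW _ (@curve_continuous _ _ e)) => x.
    by rewrite /I2 /= !in_itv /=; lra.
have Ez : forall x, E x <-> edge_set e x /\ x <> arc_point A s.
  move=> x; split.
    case=> -[t]; rewrite /I1 /I2 /= in_itv /= => ht <-; split.
    - by exists t => //=; rewrite in_itv /=; lra.
    - rewrite -et0 => /(@curve_injective _ _ e) h.
      by have := h ltac:(lra) ltac:(lra) ltac:(lra); lra.
    - by exists t => //=; rewrite in_itv /=; lra.
    - rewrite -et0 => /esym /(@curve_injective _ _ e) h.
      by have := h ltac:(lra) ltac:(lra) ltac:(lra); lra.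
  case=> -[t]; rewrite /= in_itv /= => ht <- hne.
  have [tt0|tt0|tt0] := ltgtP t t0; last by rewrite tt0 et0 in hne.
  - by left; exists t => //; rewrite /I1 /= in_itv /=; lra.
  - by right; exists t => //; rewrite /I2 /= in_itv /=; lra.
pose P := arc_point A @` `[0, s[%classic; pose Q := arc_point A @` `]s, l]%classic.
have EPQ : E `<=` P `|` Q.
  move=> x /Ez[]; rewrite eA => -[t]; rewrite /= in_itv /= => ht <- hne.
  have [ts|ts|ts] := ltgtP t s; last by rewrite ts in hne.
  - by left; exists t => //=; rewrite in_itv /=; lra.
  - by right; exists t => //=; rewrite in_itv /=; lra.
(* On the arc the same set splits: the closure of each half lies in the image of a closed interval,
   which misses the other half by injectivity. *)
have PQ : separated P Q.
  have cP : closure P `<=` arc_point A @` `[0, s]%classic.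
    rewrite [X in _ `<=` X]((closure_id _).1 (@arc_image_closed A _ _)).
    apply: closure_subset => x [t]; rewrite /= in_itv /= => ht <-.
    by exists t => //=; rewrite in_itv /=; lra.
  have cQ : closure Q `<=` arc_point A @` `[s, l]%classic.
    rewrite [X in _ `<=` X]((closure_id _).1 (@arc_image_closed A _ _)).
    apply: closure_subset => x [t]; rewrite /= in_itv /= => ht <-.
    by exists t => //=; rewrite in_itv /=; lra.
  split; apply/eqP/negPn/negP => /set0P[x [h1 h2]].
    have [t1] := cP _ h1; case: h2 => t2; rewrite /= !in_itv /= => ht2 <- ht1.
    by move/inj => h; have := h ltac:(lra) ltac:(lra); lra.
  have [t1] := cQ _ h2; case: h1 => t2; rewrite /= !in_itv /= => ht2 <- ht1.
  by move/inj => h; have := h ltac:(lra) ltac:(lra); lra.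
have [sub|sub] := connected_subset PQ EPQ cE.
- have : E (arc_point A l).
    apply/Ez; split; first by rewrite eA; exists l => //=; rewrite in_itv /=; lra.
    by move=> /inj h; have := h ltac:(lra) ltac:(lra); lra.
  move/sub => -[t]; rewrite /= in_itv /= => ht /inj h.
  by have := h ltac:(lra) ltac:(lra); lra.
- have : E (arc_point A 0).
    apply/Ez; split; first by rewrite eA; exists 0 => //=; rewrite in_itv /=; lra.
    by move=> /inj h; have := h ltac:(lra) ltac:(lra); lra.
  move/sub => -[t]; rewrite /= in_itv /= => ht /inj h.
  by have := h ltac:(lra) ltac:(lra); lra.
Qed.

End Complex.
End Topology.

(** * Generic lines *)

Section FiniteBad.
Variable R : realType.
Implicit Types (p q u v w : R * R) (A : arc R).

(** A root [m1] splits off the factor [m - m1] and leaves at most one other root. The conditions on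
    slopes below are all reduced to such an equation. *)
Lemma quad_finite (a b c : R) : [|| a != 0, b != 0 | c != 0] ->
  finite_set [set m : R | a * m ^+ 2 + b * m + c = 0].
Proof.
move=> nz; have [[m1 h1]|none] := pselect (exists m1, a * m1 ^+ 2 + b * m1 + c = 0);
  last first.
  rewrite (_ : mkset _ = set0) //.
  by apply/seteqP; split=> m //= hm; apply: none; exists m.
have fact m : a * m ^+ 2 + b * m + c = 0 -> m = m1 \/ a * m + (a * m1 + b) = 0.
  move=> hm; have : (m - m1) * (a * m + (a * m1 + b)) = 0.
    rewrite -[RHS](subrr (0 : R)) -{1}hm -{1}h1; ring.
  move/eqP; rewrite mulf_eq0 subr_eq0 => /orP[/eqP|/eqP]; by [left | right].
apply: (@sub_finite_set _ _ [set m1; - (a * m1 + b) / a]); last exact: finite_set2.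
move=> m /fact[->|]; first by left.
have [a0|a0] := eqVneq a 0; last first.
  by move=> h; right; rewrite /=; apply: (mulfI a0); rewrite [RHS]mulrC divfK //; lra.
have b0 : b != 0.
  move: nz; rewrite a0 eqxx /=; apply: contraTneq => b0.
  by rewrite b0 eqxx /= negbK; move: h1; rewrite a0 b0 !mul0r !add0r => ->.
by move=> h; exfalso; move/negP: b0; apply; apply/eqP; move: h; rewrite a0; lra.
Qed.

Lemma cross_vanish u0 u1 w : cross u0 u1 != 0 -> cross w u0 = 0 ->
  cross w u1 = 0 -> w = 0.
Proof.
move=> h h0 h1; apply: (basis_vanish h) => //.
have -> : cross u0 w = - cross w u0 by rewrite /cross; ring.
by rewrite h0 oppr0.
Qed.

Lemma dot_vanish u0 u1 w : cross u0 u1 != 0 -> dot u0 w = 0 ->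
  dot u1 w = 0 -> w = 0.
Proof.
move=> h h0 h1; have e1 : cross u0 u1 * w.1 = dot u0 w * u1.2 - dot u1 w * u0.2.
  by rewrite /cross /dot; ring.
have e2 : cross u0 u1 * w.2 = dot u1 w * u0.1 - dot u0 w * u1.1.
  by rewrite /cross /dot; ring.
by apply: pointP; apply: (mulfI h); rewrite ?e1 ?e2 h0 h1 /=; ring.
Qed.

(** [w - q] must be parallel to [u0 + m *: u1], a linear equation in [m] that is nontrivial because
    [u0] and [u1] are independent. *)
Lemma line_point_finite q u0 u1 w : cross u0 u1 != 0 -> w != q ->
  finite_set [set m : R | exists t : R, q + t *: (u0 + m *: u1) = w].
Proof.
move=> h wq; apply: (@sub_finite_set _ _
  [set m | 0 * m ^+ 2 + cross (w - q) u1 * m + cross (w - q) u0 = 0]).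
  by move=> m [t <-]; rewrite /cross /= /GRing.scale /=; ring.
apply: quad_finite; rewrite eqxx /= -negb_and; apply: contraNN wq.
by move=> /andP[/eqP h1 /eqP h0]; rewrite -subr_eq0 (cross_vanish h h0 h1).
Qed.

Lemma dotDl u v w : dot (u + v) w = dot u w + dot v w.
Proof. by rewrite /dot /=; ring. Qed.

Lemma dotZl u v (a : R) : dot (a *: u) v = a * dot u v.
Proof. by rewrite /dot /= /GRing.scale /=; ring. Qed.

(** The parameter [s] is unrestricted, so this is about the whole line or circle carrying [A]. The
    exceptional slopes are the direction of that line, or those of the tangents from [q] to that
    circle. *)
Lemma line_arc_generic A q u0 u1 : cross u0 u1 != 0 ->
  exists2 bad : set R, finite_set bad & forall m, ~ bad m ->
    finite_set [set t : R | exists s, q + t *: (u0 + m *: u1) = arc_point A s] /\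
    forall t s, q + t *: (u0 + m *: u1) = arc_point A s ->
      dot (u0 + m *: u1) (arc_normal A s) != 0.
Proof.
move=> h; have [k0|k0] := eqVneq (arc_curv A) 0.
  have Nc s : arc_normal A s = arc_normal A 0 by rewrite /arc_normal k0 !mul0r.
  have Pc s : dot (arc_point A s) (arc_normal A 0) = dot (arc_point A 0) (arc_normal A 0).
    rewrite -[s in LHS]add0r arc_point_expand /arc_cos k0 eqxx scale0r addr0.
    by rewrite dotDl dotZl dot_tangent_normal mulr0 addr0.
  pose N := arc_normal A 0.
  exists [set m | 0 * m ^+ 2 + dot u1 N * m + dot u0 N = 0].
    apply: quad_finite; rewrite eqxx /= -negb_and.
    apply/negP => /andP[/eqP h1 /eqP h0].
    have := dot_normal A 0; rewrite -/N (dot_vanish h h0 h1) /dot /=; lra.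
  move=> m hm.
  have nz : dot (u0 + m *: u1) N != 0.
    by apply/negP => /eqP; rewrite dotDl dotZl => h0; apply: hm => /=; lra.
  split=> [|t s _]; last by rewrite Nc.
  apply: (@sub_finite_set _ _ [set t | 0 * t ^+ 2 + dot (u0 + m *: u1) N * t +
     (dot q N - dot (arc_point A 0) N) = 0]); last first.
    by apply: quad_finite; rewrite nz orbT.
  move=> t [s hs] /=; have := Pc s; rewrite -/N -hs dotDl dotZl; lra.
pose c := arc_center A; pose k := arc_curv A; pose w := c - q.
(* A line is tangent if its distance to the centre is the radius, that is
   [k ^+ 2 * cross w v ^+ 2 = dot v v], which is quadratic in [m]. If all coefficients vanished, so
   would [cross u0 u1 ^+ 2 = dot u0 u0 * dot u1 u1 - dot u0 u1 ^+ 2]. *)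
exists [set m | (k ^+ 2 * cross w u1 ^+ 2 - dot u1 u1) * m ^+ 2 +
   (2 * (k ^+ 2 * cross w u0 * cross w u1 - dot u0 u1)) * m +
   (k ^+ 2 * cross w u0 ^+ 2 - dot u0 u0) = 0].
  apply: quad_finite; rewrite -!negb_and; apply/negP => /and3P[].
  rewrite subr_eq0 mulf_eq0 pnatr_eq0 /= !subr_eq0 => /eqP h1 /eqP h2 /eqP h3.
  have : cross u0 u1 ^+ 2 = dot u0 u0 * dot u1 u1 - dot u0 u1 ^+ 2.
    by rewrite /cross /dot; ring.
  rewrite -h1 -h2 -h3 => hc; apply/negP: h; rewrite -sqrf_eq0 hc.
  by apply/negPn/eqP; ring.
move=> m hm; pose v := u0 + m *: u1.
have hv : k ^+ 2 * cross w v ^+ 2 != dot v v.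
  apply/negP => /eqP hv; apply: hm => /=.
  transitivity (k ^+ 2 * cross w v ^+ 2 - dot v v); last by rewrite hv subrr.
  by rewrite /v /cross /dot /= /GRing.scale /=; ring.
split; last first.
  move=> t s hs; apply/negP => /eqP hN; move/negP: hv; apply; apply/eqP.
  have hw : w = t *: v + k^-1 *: arc_normal A s.
    rewrite /w; have -> : q = arc_point A s - t *: v by rewrite -hs addrK.
    rewrite arc_point_center // -/k -/c.
    by apply: pointP; rewrite /= /GRing.scale /=; ring.
  have -> : cross w v = k^-1 * cross (arc_normal A s) v.
    by rewrite hw /cross /= /GRing.scale /=; ring.
  have : cross (arc_normal A s) v ^+ 2 =
     dot v v * dot (arc_normal A s) (arc_normal A s) - dot v (arc_normal A s) ^+ 2.
    by rewrite /cross /dot; ring.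
  rewrite hN dot_normal expr0n mulr1 subr0 => hc.
  by rewrite exprMn hc; field.
have vv : dot v v != 0.
  apply/negP => /eqP hv0; apply/negP: h; apply/negPn/eqP.
  have : v.1 ^+ 2 + v.2 ^+ 2 = 0 by rewrite -[RHS]hv0 /dot; ring.
  have : cross u0 u1 = cross v u1 by rewrite /v /cross /= /GRing.scale /=; ring.
  move=> -> h2; have [v1 v2] : v.1 = 0 /\ v.2 = 0 by split; nra.
  by rewrite /cross v1 v2; ring.
apply: (@sub_finite_set _ _ [set t | dot v v * t ^+ 2 + (- 2 * dot w v) * t +
     (dot w w - k^-1 ^+ 2) = 0]); last by apply: quad_finite; rewrite vv.
move=> t [s hs] /=.
have hw : w - t *: v = k^-1 *: arc_normal A s.
  rewrite /w -addrA -opprD /= -/v in hs *.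
  rewrite hs arc_point_center // -/k -/c.
  by apply: pointP; rewrite /= /GRing.scale /=; ring.
have : dot (w - t *: v) (w - t *: v) = k^-1 ^+ 2.
  by rewrite hw dotZl dotZr dot_normal; ring.
by rewrite /dot /= /GRing.scale /=; lra.
Qed.

Lemma finite_itv_notin (bad : set R) (a b : R) : a < b -> finite_set bad ->
  exists2 m, a < m < b & ~ bad m.
Proof.
move=> ab fb; apply: contrapT => hn.
(* With [k.+2] instead of [k.+1] all values stay strictly below [b]. *)
pose f (k : nat) : R := a + (b - a) / k.+2%:R.
have fab k : a < f k < b.
  have k0 : 0 < k.+2%:R :> R by rewrite ltr0n.
  have k1 : 1 < k.+2%:R :> R by rewrite ltr1n.
  rewrite /f ltrDl divr_gt0 ?subr_gt0 //= -ltrBrDl ltr_pdivrMr //.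
  by rewrite ltr_pMr ?subr_gt0.
apply: infinite_nat; rewrite (_ : setT = f @^-1` bad).
  apply: finite_preimage => // i j _ _ /addrI /mulfI.
  rewrite subr_eq0 gt_eqF // => /(_ isT) /invr_inj /eqP.
  by rewrite eqr_nat => /eqP [].
apply/seteqP; split=> // k _; apply: contrapT => hk; apply: hn.
by exists (f k).
Qed.

End FiniteBad.

(** * Regions and pressure *)

Section Regions.
Variables (R : realType) (n : nat) (B : bubble_complex R n).
Implicit Types (p q u v w : R * R) (A : arc R) (i j : option 'I_n) (e : edge B).

Lemma region_inj i j x : region B i x -> region B j x -> i = j.
Proof.
by move=> hi hj; apply: (region_disjoint (b := B)) => //; exists x.
Qed.

Lemma region_support i x : region B i x -> ~ support B x.
Proof.
move=> hi; have : (\bigcup_i region B i) x by exists i.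
by rewrite region_cover.
Qed.

Lemma region_exists x : ~ support B x -> exists i, region B i x.
Proof.
move=> hx; have : (\bigcup_i region B i) x by rewrite region_cover.
by case=> i _ hi; exists i.
Qed.

Lemma region_segment i p q : region B i p ->
  (forall r, segment p q r -> ~ support B r) -> region B i q.
Proof.
move=> hp sub; apply: (region_faces hp); apply: component_segment sub.
by apply: connected_component_refl; exact: region_support hp.
Qed.

Lemma region_open i : open (region B i).
Proof.
apply: open_boxI => p hp.
have oS : open (~` support B) by apply: closed_openC; exact: support_closed.
have [e e0 he] := open_boxP oS (region_support hp).
exists e => // q h1 h2; apply: (region_segment hp) => r [t t01 ->].
apply: he => /=; rewrite /GRing.scale /= addrC addKr.
  exact: le_lt_trans (ler_unit_norm _ t01) h1.
exact: le_lt_trans (ler_unit_norm _ t01) h2.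
Qed.

(** There is no graph outside a large square, and four overlapping half-planes join every outer
    point to the corner [(c, c)], so a single region lies there. It is the exterior one: otherwise
    the exterior region would be inside the square and have finite area. *)
Lemma exterior_far : exists M : R, forall x, M < `|x.1| \/ M < `|x.2| ->
  region B None x.
Proof.
have [M0 hM0] := support_bounded B.
pose M := Num.max M0 0; exists M.
have M_ge0 : 0 <= M by rewrite le_max lexx orbT.
have hM x : support B x -> `|x.1| <= M /\ `|x.2| <= M.
  by move=> /hM0[h1 h2]; split; rewrite le_max ?h1 ?h2.
have [x0 N0 x0M] : exists2 x, region B None x & M < `|x.1| \/ M < `|x.2|.
  apply: contrapT => hn; have : (area (region B None) < +oo)%E.
    apply: (@area_box _ M); first exact: region_open.
    move=> x hx; split; rewrite leNgt; apply/negP => h; apply: hn; exists x => //.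
      by left.
    by right.
  by rewrite exterior_area ltxx.
have half i p q (f : R * R -> R) :
    (forall t : R, f (p + t *: (q - p)) = f p + t * (f q - f p)) ->
    (forall x, M < f x -> ~ support B x) -> M < f p -> M < f q ->
    region B i p -> region B i q.
  move=> lf fS fp fq hp; apply: (region_segment hp) => r [t /andP[t0 t1] ->].
  apply: fS; rewrite lf; have [h|h] := lerP (f p) (f q).
    by have : 0 <= t * (f q - f p) by [rewrite mulr_ge0 // subr_ge0]; lra.
  have : 0 <= (1 - t) * (f p - f q) by rewrite mulr_ge0 // subr_ge0 // ltW.
  lra.
have lin1 p q (t : R) : (p + t *: (q - p)).1 = p.1 + t * (q.1 - p.1) by [].
have lin2 p q (t : R) : (p + t *: (q - p)).2 = p.2 + t * (q.2 - p.2) by [].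
have right_half i p q : M < p.1 -> M < q.1 -> region B i p -> region B i q.
  apply: (half i p q (fun x => x.1)) => [t|x h /hM[]]; first exact: lin1.
  by rewrite ler_norml; lra.
have left_half i p q : p.1 < - M -> q.1 < - M -> region B i p -> region B i q.
  move=> h1 h2; apply: (half i p q (fun x => - x.1)) => [t|x h /hM[]||]; try lra.
    by rewrite lin1; ring.
  by rewrite ler_norml; lra.
have up_half i p q : M < p.2 -> M < q.2 -> region B i p -> region B i q.
  apply: (half i p q (fun x => x.2)) => [t|x h /hM[_]]; first exact: lin2.
  by rewrite ler_norml; lra.
have low_half i p q : p.2 < - M -> q.2 < - M -> region B i p -> region B i q.
  move=> h1 h2; apply: (half i p q (fun x => - x.2)) => [t|x h /hM[_]||]; try lra.
    by rewrite lin2; ring.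
  by rewrite ler_norml; lra.
pose c := M + 1.
have to_corner i p : M < `|p.1| \/ M < `|p.2| -> region B i p -> region B i (c, c).
  case=> hp hi.
    have [p0|p0] := lerP 0 p.1.
      by apply: (right_half _ p) => //; rewrite /c /= ?ger0_norm // in hp *; lra.
    rewrite ltr0_norm // in hp.
    apply: (up_half _ (- c, c)); rewrite /c /=; try lra.
    by apply: (left_half _ p) => //=; lra.
  have [p0|p0] := lerP 0 p.2.
    by apply: (up_half _ p) => //; rewrite /c /= ?ger0_norm // in hp *; lra.
  rewrite ltr0_norm // in hp.
  apply: (right_half _ (c, - c)); rewrite /c /=; try lra.
  by apply: (low_half _ p) => //=; lra.
move=> x hx; have [i hi] : exists i, region B i x.
  by apply: region_exists => /hM[h1 h2]; case: hx => h; lra.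
by rewrite (region_inj (to_corner _ _ x0M N0) (to_corner _ _ hx hi)).
Qed.

Lemma exterior_ray q v (h : R) : v != 0 ->
  exists2 t : R, h < t & region B None (q - t *: v).
Proof.
have [M hM] := exterior_far => v0.
have main (x y : R) : y != 0 -> exists2 t : R, h < t & M < `|x - t * y|.
  move=> y0; have ny : 0 < `|y| by rewrite normr_gt0.
  pose t := `|h| + 1 + (`|x| + `|M|) / `|y|.
  have t0 : 0 <= t by rewrite /t addr_ge0 ?divr_ge0 ?addr_ge0.
  exists t.
    apply: (@le_lt_trans _ _ `|h|); first exact: ler_norm.
    by rewrite /t -addrA ltrDl ltr_pwDl // divr_ge0 // addr_ge0.
  have : t * `|y| - `|x| <= `|x - t * y|.
    by rewrite distrC -[t in leLHS](ger0_norm t0) -normrM; exact: lerB_dist.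
  apply: lt_le_trans; rewrite /t mulrDl divfK ?gt_eqF //.
  have : 0 < (`|h| + 1) * `|y| by apply: mulr_gt0 => //; rewrite ltr_wpDl.
  have := ler_norm M; lra.
have [v1|v1] := eqVneq v.1 0; last first.
  by have [t ht h1] := main q.1 _ v1; exists t => //; apply: hM; left.
have v2 : v.2 != 0 by apply: contraNneq v0 => h2; apply/eqP; exact: pointP.
by have [t ht h1] := main q.2 _ v2; exists t => //; apply: hM; right.
Qed.

Lemma is_derive_line p v (t : R) : is_derive t 1 (fun x : R => p + x *: v) v.
Proof.
have c : (fun h : R => h^-1 *: (((fun x : R => p + x *: v) \o shift t) (h *: (1 : R)) -
    (p + t *: v))) @ 0^' --> v.
  apply: cvg_near_cst; near=> h.
  have h0 : h != 0 by near: h; exact: nbhs_dnbhs_neq.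
  by apply: pointP; rewrite /= /GRing.scale /=; field.
apply: DeriveDef; first by apply/cvg_ex; exists v.
by rewrite /derive; apply: cvg_lim => //; exact: norm_hausdorff.
Unshelve. all: by end_near. Qed.

(* Pulling the affine path back to [0, 1] only multiplies its velocity by the
   positive factor [b - a], so the signs of the crossings are those of [v]. *)
Lemma crossing_line i q v (a b : R) (Z : seq R) (k : R -> R) : a < b -> uniq Z ->
  (forall t, a <= t <= b -> (t \in Z <-> support B (q + t *: v))) ->
  region B None (q + a *: v) -> region B i (q + b *: v) ->
  (forall t, t \in Z -> a < t < b -> exists e A s,
     [/\ is_edge_arc e A, 0 < s < arc_len A, q + t *: v = arc_point A s,
         dot v (arc_normal A s) != 0 &
         k t = Num.sg (dot v (arc_normal A s)) * arc_curv A]) ->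
  crossing_sum B i (\sum_(t <- Z | a < t < b) k t).
Proof.
move=> ab uZ hZ ha hb hk.
have ba : 0 < b - a by rewrite subr_gt0.
pose f (x : R) := (x - a) / (b - a).
have fK (x : R) : a + f x * (b - a) = x by rewrite /f divfK ?gt_eqF //; lra.
have Kf (x : R) : f (a + x * (b - a)) = x by rewrite /f addrC addKr mulfK ?gt_eqF.
pose w := (b - a) *: v.
have gE (x : R) : q + a *: v + x *: w = q + (a + x * (b - a)) *: v.
  by apply: pointP; rewrite /= /GRing.scale /=; ring.
have off (x : R) : 0 <= x <= 1 -> support B (q + (a + x * (b - a)) *: v) ->
    a < a + x * (b - a) < b.
  move=> hx hS; rewrite !lt_neqAle; apply/andP; split; apply/andP; split; try nra.
    by apply/eqP => h; rewrite -h in hS; exact: region_support ha hS.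
  by apply/eqP => h; rewrite h in hS; exact: region_support hb hS.
exists (fun x => q + a *: v + x *: w), [seq f t | t <- Z & a < t < b],
  (fun x => k (a + x * (b - a))); split.
- by apply: continuous_subspaceT => t; exact: line_continuous.
- by rewrite !gE mul0r addr0 mul1r subrKC.
- split; first by rewrite map_inj_uniq ?filter_uniq // => x y /(congr1 (fun z => a + z * (b - a))); rewrite !fK.
  move=> t; split.
    case/mapP=> x; rewrite mem_filter => /andP[xab xZ] ->.
    rewrite gE fK; split; last by apply/hZ => //; lra.
    by rewrite /f divr_ge0 /= ?ler_pdivrMr; lra.
  rewrite gE => -[t01 hS]; have hab := off _ t01 hS.
  apply/mapP; exists (a + t * (b - a)); last by rewrite Kf.
  by rewrite mem_filter hab /=; apply/hZ => //; lra.
- move=> t /mapP[x]; rewrite mem_filter => /andP[xab xZ] ->.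
  have [e [A [s [eA sl hs hN hkx]]]] := hk _ xZ xab.
  exists e, A, s, w; split=> //; rewrite ?gE ?fK //.
    exact: is_derive_line.
  rewrite /w dotZl; split; first by rewrite mulf_neq0 // gt_eqF.
  by rewrite hkx sgrM (gtr0_sg ba) mul1r.
- by rewrite big_map big_filter; apply: eq_bigr => x _; rewrite fK.
Qed.

End Regions.

(** * The sign of the curvature seen from an interior region *)

Section Pressure.
Variables (R : realType) (n : nat) (B : bubble_complex R n).
Hypothesis Breg : regular B.
Implicit Types (p q u v w : R * R) (A : arc R) (e : edge B).

Definition transversal_at q v (t : R) (k : R) := exists e A s,
  [/\ is_edge_arc e A, 0 < s < arc_len A, q + t *: v = arc_point A s,
      dot v (arc_normal A s) != 0 &
      k = Num.sg (dot v (arc_normal A s)) * arc_curv A].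

(** The slope avoids tangency to the edges and the ends of the arcs other than [q]. The parameter 0
    is left out of the second claim because [q] itself may be an end of one of the chosen arcs. *)
Lemma generic_line q u0 u1 : cross u0 u1 != 0 -> exists m : R,
  let v := u0 + m *: u1 in
  finite_set [set t : R | support B (q + t *: v)] /\
  forall t, t != 0 -> support B (q + t *: v) -> exists k, transversal_at q v t k.
Proof.
move=> h.
have /choice[arcs harcs] : forall e : edge B, exists A, is_edge_arc e A.
  exact: regular_curvature.
have /choice[bad hbad] : forall e : edge B, exists bad : set R,
    finite_set bad /\ forall m, ~ bad m ->
    finite_set [set t : R | exists s, q + t *: (u0 + m *: u1) = arc_point (arcs e) s] /\
    forall t s, q + t *: (u0 + m *: u1) = arc_point (arcs e) s ->
      dot (u0 + m *: u1) (arc_normal (arcs e) s) != 0.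
  by move=> e; have [b b1 b2] := line_arc_generic (arcs e) q h; exists b.
pose ends w : set R := [set m | w != q /\ exists t : R, q + t *: (u0 + m *: u1) = w].
have fends w : finite_set (ends w).
  have [wq|wq] := eqVneq w q.
    by rewrite (_ : ends w = set0) //; apply/seteqP; split=> m // [/negP]; rewrite wq.
  by apply: sub_finite_set (line_point_finite h wq) => m [].
pose badm := \bigcup_(e in [set: edge B])
  (bad e `|` ends (arc_point (arcs e) 0) `|` ends (arc_point (arcs e) (arc_len (arcs e)))).
have fbad : finite_set badm.
  apply: bigcup_finite => [|e _]; first exact: finite_finset.
  by rewrite !finite_setU; split; [split; [exact: (hbad e).1|]|].
have [m _ hm] := finite_itv_notin (@ltr01 R) fbad.
exists m => v; split.
  apply: (@sub_finite_set _ _ (\bigcup_(e in [set: edge B])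
      [set t : R | exists s, q + t *: v = arc_point (arcs e) s])).
    move=> t [e]; have [_ _ -> _] := harcs e; case=> s _ hs.
    by exists e => //; exists s.
  apply: bigcup_finite => [|e _]; first exact: finite_finset.
  by apply: (proj1 ((hbad e).2 m _)) => hb; apply: hm; exists e => //; left; left.
have v0 : v != 0.
  apply: contraNneq h => v0.
  have -> : cross u0 u1 = cross v u1 by rewrite /v /cross /= /GRing.scale /=; ring.
  by rewrite v0 /cross /= !mul0r subrr.
move=> t t0 [e]; have eA := harcs e; have [_ _ imA _] := eA.
rewrite imA => -[s]; rewrite /= in_itv /= => /andP[s0 sl] hs.
have ne x : x = q + t *: v -> x != q.
  by move=> ->; rewrite addrC -subr_eq0 addrK scaler_eq0 negb_or t0 v0.
exists (Num.sg (dot v (arc_normal (arcs e) s)) * arc_curv (arcs e)), e, (arcs e), s.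
split=> //.
  rewrite !lt_neqAle s0 sl !andbT; apply/andP; split; apply/negP => /eqP hse; apply: hm;
    exists e => //.
    by left; right; split; [apply: ne; rewrite hse | exists t; rewrite -/v hse hs].
  by right; split; [apply: ne; rewrite -hse | exists t; rewrite -/v -hse hs].
apply: (proj2 ((hbad e).2 m _)) (esym hs) => hb.
by apply: hm; exists e => //; left; left.
Qed.

Variable P : R.
Hypothesis P_gt0 : 0 < P.
Hypothesis pressureP : forall i : 'I_n, crossing_sum B (Some i) = [set P].

(** The short segment is an admissible path with one crossing, so its crossing sum has a single
    term. *)
Lemma exterior_crossing (e : edge B) A s v (h : R) i : is_edge_arc e A ->
  0 < s < arc_len A -> 0 < h -> dot v (arc_normal A s) != 0 ->
  (forall t, - h <= t <= h -> support B (arc_point A s + t *: v) -> t = 0) ->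
  region B None (arc_point A s - h *: v) ->
  region B (Some i) (arc_point A s + h *: v) ->
  P = Num.sg (dot v (arc_normal A s)) * arc_curv A.
Proof.
move=> eA hs h0 hN off hext hint.
pose k (t : R) := Num.sg (dot v (arc_normal A s)) * arc_curv A.
have : crossing_sum B (Some i) (\sum_(t <- [:: 0] | - h < t < h) k t).
  apply: (@crossing_line _ _ _ _ (arc_point A s) v); rewrite ?scaleNr //.
  - lra.
  - move=> t ht; rewrite inE; split=> [/eqP->|/(off _ ht)->//].
    rewrite scale0r addr0; have [_ _ imA _] := eA.
    by exists e; rewrite imA; exists s => //=; rewrite in_itv /=; lra.
  - move=> t; rewrite inE => /eqP -> _; exists e, A, s; split=> //.
    by rewrite scale0r addr0.
by rewrite pressureP /= big_cons big_nil oppr_lt0 h0 addr0.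
Qed.

(** The edge does not bulge into region [i], which lies on its side [g]; [side] is asked for all
    slopes because genericity chooses the slope. If the exterior is just behind the point, the
    crossing carries the whole pressure [P > 0]. If an interior region is there, the same line
    followed from the exterior to just before and just after the point gives the sum [P] twice, so
    the term of the point is zero. *)
Lemma pressure_side (e : edge B) A s (g : R) i : is_edge_arc e A ->
  0 < s < arc_len A -> g = 1 \/ g = -1 ->
  (forall m : R, exists2 d : R, 0 < d & forall h, 0 < h < d ->
     region B (Some i) (arc_point A s + h *: (g *: arc_normal A s + m *: arc_tangent A s))) ->
  0 <= g * arc_curv A.
Proof.
move=> eA hs hg side; set q := arc_point A s in side *.
set N := arc_normal A s in side *; set T := arc_tangent A s in side *.
have c0 : cross (g *: N) T != 0.
  have -> : cross (g *: N) T = - g * cross T N by rewrite /cross /= /GRing.scale /=; ring.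
  by rewrite cross_tangent_normal mulr1 oppr_eq0; case: hg => ->; rewrite ?oppr_eq0 oner_eq0.
have [m [fin trans]] := generic_line q c0.
set v := g *: N + m *: T in fin trans.
have vN : dot v N = g.
  rewrite dotDl !dotZl dot_normal (_ : dot T N = 0) ?mulr0 ?addr0 ?mulr1 //.
  exact: dot_tangent_normal.
have g0 : g != 0 by case: hg => ->; rewrite ?oppr_eq0 oner_eq0.
have sgg : Num.sg g = g by case: hg => ->; rewrite ?sgrN sgr1.
have v0 : v != 0 by apply: contraNneq g0 => v0; rewrite -vN v0 /dot /= !mul0r addr0.
have [d d0 hd] := side m; rewrite -/v in hd.
have [Z0s hZ0s] := (finite_seqP _).1 fin; pose Z := undup Z0s.
have uZ : uniq Z by exact: undup_uniq.
have hZ t : t \in Z <-> support B (q + t *: v).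
  rewrite mem_undup; have : [set t : R | support B (q + t *: v)] t <-> [set` Z0s] t.
    by rewrite -hZ0s.
  by case=> h1 h2; split=> [/h2|/h1].
have Z0 : 0 \in Z.
  apply/hZ; rewrite scale0r addr0; have [_ _ imA _] := eA.
  by exists e; rewrite imA; exists s => //=; rewrite in_itv /=; lra.
have [h [h0 hdh hmin]] : exists h, [/\ 0 < h, h < d & forall t, t \in Z -> t != 0 -> h < `|t|].
  elim: (Z) => [|x l [h [h0 hd' IH]]]; first by exists (d / 2); split=> //; lra.
  have [->|x0] := eqVneq x 0.
    exists h; split=> // t; rewrite inE => /orP[/eqP->|]; first by rewrite eqxx.
    exact: IH.
  have nx : 0 < `|x| by rewrite normr_gt0.
  exists (Num.min h (`|x| / 2)); split.
  - by rewrite lt_min h0 /=; lra.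
  - by rewrite gt_min hd'.
  - move=> t; rewrite inE gt_min => /orP[/eqP-> _|tl t0]; last by rewrite IH.
    by apply/orP; right; lra.
have hint : region B (Some i) (q + h *: v) by apply: hd; rewrite h0.
have offZ (t : R) : - h <= t <= h -> support B (q + t *: v) -> t = 0.
  move=> ht /hZ tZ; apply/eqP/negPn/negP => t0.
  by have := hmin _ tZ t0; rewrite real_ltNge ?num_real // ler_norml ht.
have [j hj] : exists j, region B j (q - h *: v).
  apply: region_exists; rewrite -scaleNr => /offZ; rewrite lexx /=.
  by move=> /(_ ltac:(lra)); lra.
case: j hj => [j|] hj; last first.
  have := exterior_crossing eA hs h0 _ offZ hj hint.
  by rewrite -/N vN sgg => /(_ g0) <-; exact: ltW.
have [t1 ht1 far] := exterior_ray B q h v0.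
have /choice[k0 hk0] : forall t, exists k, t != 0 -> t \in Z -> transversal_at q v t k.
  move=> t; have [t0|] := eqVneq t 0; first by exists 0.
  move=> t0; have [/hZ tZ|] := boolP (t \in Z); last by exists 0.
  by have [k hk] := trans _ t0 tZ; exists k.
(* Genericity says nothing at [t = 0], where the given edge and arc are used. *)
pose k t := if t == 0 then g * arc_curv A else k0 t.
have hk t : t \in Z -> transversal_at q v t (k t).
  rewrite /k; case: eqVneq => [-> _|t0 tZ]; last exact: hk0.
  exists e, A, s; split=> //; rewrite -/N ?vN ?sgg //.
  by rewrite scale0r addr0.
have far' : region B None (q + (- t1) *: v) by rewrite scaleNr.
have s1 := @crossing_line _ _ B (Some i) q v (- t1) h Z k ltac:(lra) uZ
  (fun t _ => hZ t) far' hint (fun t tZ _ => hk t tZ).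
have hj' : region B (Some j) (q + (- h) *: v) by rewrite scaleNr.
have s2 := @crossing_line _ _ B (Some j) q v (- t1) (- h) Z k ltac:(lra) uZ
  (fun t _ => hZ t) far' hj' (fun t tZ _ => hk t tZ).
move: s1 s2; rewrite !pressureP /= => s1 s2.
have : \sum_(t <- Z | - t1 < t < h) k t =
       k 0 + \sum_(t <- Z | - t1 < t < - h) k t.
  rewrite big_mkcond (bigD1_seq 0) //= oppr_lt0 h0 (lt_trans h0 ht1) /=; congr (_ + _).
  rewrite big_mkcond [RHS]big_mkcond /= !big_seq; apply: eq_bigr => t tZ.
  have [->|t0] := eqVneq t 0.
    have -> : 0 < - h = false by apply/negbTE; rewrite -leNgt; lra.
    by rewrite andbF.
  have := hmin _ tZ t0; case: (ger0P t) => ht hlt /=.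
    have -> : t < h = false by apply/negbTE; rewrite -leNgt ltW.
    have -> : t < - h = false by apply/negbTE; rewrite -leNgt; lra.
    by rewrite !andbF.
  have -> : t < h by lra.
  by have -> : t < - h by lra.
rewrite s1 s2 /k eqxx => hP.
by move: hP; lra.
Qed.

End Pressure.

(** * Local structure of the graph *)

Section Local.
Variables (R : realType) (n : nat) (B : bubble_complex R n).
Hypothesis Breg : regular B.
Implicit Types (p q u v w : R * R) (A : arc R) (e : edge B).

(** The coordinates of the error in the basis [d], [w] are given by Cramer's rule; [M] bounds the
    numerators relative to the size of the error. *)
Lemma tangent_coords (E : set (R * R)) q d w (a b : R) : cross d w != 0 ->
  tangent_dir E q (a *: d + b *: w) -> forall eps : R, 0 < eps ->
  exists2 del : R, 0 < del & forall h, 0 < h < del -> exists a' b' : R,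
    [/\ `|a' - a| < eps, `|b' - b| < eps & E (q + (h * a') *: d + (h * b') *: w)].
Proof.
move=> c0 tE eps eps0.
pose M := `|d.1| + `|d.2| + `|w.1| + `|w.2| + 1.
have M0 : 0 < M by rewrite /M ltr_pwDr // !addr_ge0.
have nc : 0 < `|cross d w| by rewrite normr_gt0.
have eta0 : 0 < eps * `|cross d w| / M by rewrite divr_gt0 // mulr_gt0.
have [del del0 hdel] := tE _ eta0; exists del => // h hh.
have [r [r1 r2 Er]] := hdel _ hh.
have rE := basis_decomp r c0.
exists (a + cross r w / cross d w), (b + cross d r / cross d w).
have bnd (x y z t : R) : `|x| < eps * `|cross d w| / M ->
    `|y| < eps * `|cross d w| / M -> `|z| + `|t| < M ->
    `|(x * z - y * t) / cross d w| < eps.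
  move=> hx hy hzt; rewrite normrM normfV ltr_pdivrMr //.
  apply: le_lt_trans (ler_normB _ _) _; rewrite !normrM.
  apply: (@le_lt_trans _ _ (eps * `|cross d w| / M * (`|z| + `|t|))).
    by rewrite mulrDr; apply: lerD; apply: ler_wpM2r => //; exact: ltW.
  rewrite -mulrA gtr_pMr ?mulr_gt0 // mulrC ltr_pdivrMr // mul1r //.
split.
- rewrite addrC addKr; apply: bnd => //; rewrite /M.
  have := normr_ge0 d.1; have := normr_ge0 d.2; lra.
- rewrite addrC addKr.
  have -> : cross d r = r.2 * d.1 - r.1 * d.2 by rewrite /cross; ring.
  by apply: bnd => //; rewrite /M; have := normr_ge0 w.1; have := normr_ge0 w.2; lra.
- move: Er; rewrite {1}rE; congr E.
  by apply: pointP; rewrite /= /GRing.scale /=; ring.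
Qed.

(** Since [x + 2 x = 2 pi] for this angle, its cosine [c] is a root of [(c - 1) * (2 * c + 1) ^+ 2],
    and [c = 1] is excluded. *)
Lemma cos_2pi3 : cos (2 * pi / 3) = - (1 / 2) :> R.
Proof.
have hx : 2 * pi / 3 + (2 * pi / 3) *+ 2 = pi *+ 2 :> R by field.
have := cos2pi R; rewrite -hx cosD cos_mulr2n sin_mulr2n.
have -> : cos (2 * pi / 3) * (cos (2 * pi / 3) ^+ 2 *+ 2 - 1) -
   sin (2 * pi / 3) * ((cos (2 * pi / 3) * sin (2 * pi / 3)) *+ 2) =
   cos (2 * pi / 3) * (cos (2 * pi / 3) ^+ 2 *+ 2 - 1) -
   2 * cos (2 * pi / 3) * sin (2 * pi / 3) ^+ 2 :> R by ring.
rewrite sin2cos2 => hc.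
have c1 : cos (2 * pi / 3) != 1 :> R.
  apply/negP => /eqP /cos_eq1 h; have p0 := pi_gt0 R.
  have : 2 * pi / 3 = 0 :> R by apply: h; rewrite ger0_norm; lra.
  lra.
move: hc c1; set c := cos _ => hc c1.
have : (c - 1) * (2 * c + 1) ^+ 2 = 0.
  have -> : (c - 1) * (2 * c + 1) ^+ 2 =
    (c * (c ^+ 2 *+ 2 - 1) - 2 * c * (1 - c ^+ 2)) - 1 by ring.
  by rewrite hc subrr.
by move/eqP; rewrite mulf_eq0 subr_eq0 (negbTE c1) /= sqrf_eq0 => /eqP; lra.
Qed.

Lemma outgoing_tangent (d : edge B * bool) A : is_edge_arc d.1 A ->
  edge_end d \in verts B -> tangent_dir (edge_set d.1) (edge_end d) (outgoing A d.2).
Proof.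
case: d => e b /= [l0 _ imA endsA] hv.
have v0 : curve e 0 \in verts B.
  case: (curve_ends e) => [[]//|[h01 nv]]; move: hv.
  by rewrite /edge_end /=; case: b => //=; rewrite -h01 (negbTE nv).
have [h0 h1] := endsA v0; rewrite /edge_end /outgoing /=; case: b hv => /= _.
  rewrite -h1 -scaleN1r; apply: (arc_tangent_dir _ l0); first by right.
  move=> h hh; rewrite imA; exists (arc_len A + -1 * h) => //=.
  by rewrite in_itv /=; lra.
rewrite -h0 -[arc_tangent A 0]scale1r; apply: (arc_tangent_dir _ l0); first by left.
move=> h hh; rewrite imA; exists (0 + 1 * h) => //=.
by rewrite in_itv /=; lra.
Qed.

Lemma dot_outgoing A b : dot (outgoing A b) (outgoing A b) = 1.
Proof.
rewrite /outgoing; case: b; last exact: dot_tangent.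
by rewrite -[RHS](dot_tangent A (arc_len A)) /dot /=; ring.
Qed.

(** The tangents are indexed by edge-ends rather than edges, so that a loop contributes two of
    them. *)
Lemma vertex_tangents v : v \in verts B ->
  exists (d1 d2 d3 : edge B * bool) (D1 D2 D3 : R * R),
  [/\ (forall d, edge_end d = v -> d \in [:: d1; d2; d3]) /\ uniq [:: d1; d2; d3],
      [/\ edge_end d1 = v, edge_end d2 = v & edge_end d3 = v],
      [/\ tangent_dir (edge_set d1.1) v D1, tangent_dir (edge_set d2.1) v D2 &
          tangent_dir (edge_set d3.1) v D3],
      [/\ dot D1 D1 = 1, dot D2 D2 = 1 & dot D3 D3 = 1] &
      [/\ dot D1 D2 = - (1 / 2), dot D2 D3 = - (1 / 2) & dot D3 D1 = - (1 / 2)]].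
Proof.
move=> vB; have := regular_trivalent Breg vB; rewrite /degree.
set P := [pred d : edge B * bool | edge_end d == v] => cP.
have memP d : (d \in enum P) = (edge_end d == v) by rewrite mem_enum.
have uP := enum_uniq P; have sP : size (enum P) = 3%N by rewrite -cardE.
case: (enum P) sP uP memP => [|d1 [|d2 [|d3 [|? ?]]]] // _ uP memP.
have e1 : edge_end d1 = v by apply/eqP; rewrite -memP inE eqxx.
have e2 : edge_end d2 = v by apply/eqP; rewrite -memP !inE eqxx orbT.
have e3 : edge_end d3 = v by apply/eqP; rewrite -memP !inE eqxx !orbT.
have /choice[arcs harcs] : forall e : edge B, exists A, is_edge_arc e A.
  exact: regular_curvature.
pose D (d : edge B * bool) := outgoing (arcs d.1) d.2.
have tD d : edge_end d = v -> tangent_dir (edge_set d.1) v (D d).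
  by move=> hd; rewrite -{1}hd; apply: outgoing_tangent => //; rewrite hd.
have dD d d' : edge_end d = v -> edge_end d' = v -> d != d' ->
    dot (D d) (D d') = - (1 / 2).
  move=> hd hd' dd'.
  have := @regular_angles _ _ _ Breg d d' (arcs d.1) (arcs d'.1).
  rewrite hd hd' => /(_ vB erefl dd' (harcs _) (harcs _)); rewrite /angle => h.
  rewrite -cos_2pi3 -h acosK // in_itv /=.
  (* Inverting [acos] requires a value in [-1, 1]: this is Cauchy-Schwarz, read off from Lagrange's
     identity. *)
  have hsq : dot (D d) (D d') ^+ 2 <= 1.
    have := sqr_ge0 (cross (D d) (D d')).
    have -> : cross (D d) (D d') ^+ 2 =
      dot (D d) (D d) * dot (D d') (D d') - dot (D d) (D d') ^+ 2.
      by rewrite /cross /dot; ring.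
    by rewrite !dot_outgoing; lra.
  by move: hsq; set x := dot _ _ => hsq; apply/andP; split; nra.
move: (uP); rewrite /= !inE negb_or andbT => /andP[/andP[n12 n13] n23].
exists d1, d2, d3, (D d1), (D d2), (D d3); split.
- by split=> // d hd; rewrite memP hd.
- by [].
- by split; apply: tD.
- by split; exact: dot_outgoing.
- by split; apply: dD => //; rewrite eq_sym.
Qed.

Lemma unit_sum0 (D1 D2 D3 : R * R) : dot D1 D1 = 1 -> dot D2 D2 = 1 ->
  dot D3 D3 = 1 -> dot D1 D2 = - (1 / 2) -> dot D2 D3 = - (1 / 2) ->
  dot D3 D1 = - (1 / 2) -> D1 + D2 + D3 = 0.
Proof.
move=> h1 h2 h3 h12 h23 h31; set u := D1 + D2 + D3.
have : dot u u = dot D1 D1 + dot D2 D2 + dot D3 D3 + 2 * dot D1 D2 +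
   2 * dot D2 D3 + 2 * dot D3 D1 by rewrite /u /dot /=; ring.
rewrite h1 h2 h3 h12 h23 h31 => hu.
have hu0 : u.1 ^+ 2 + u.2 ^+ 2 = 0.
  by transitivity (dot u u); [rewrite /dot; ring | rewrite hu; field].
have [u1 u2] : u.1 = 0 /\ u.2 = 0.
  by move: hu0; move: (u.1) (u.2) => x y h; split; nra.
exact: pointP.
Qed.

Lemma unit_cross_neq0 (D1 D2 : R * R) : dot D1 D1 = 1 -> dot D2 D2 = 1 ->
  dot D1 D2 = - (1 / 2) -> cross D1 D2 != 0.
Proof.
move=> h1 h2 h12; rewrite -sqrf_eq0.
have -> : cross D1 D2 ^+ 2 = dot D1 D1 * dot D2 D2 - dot D1 D2 ^+ 2.
  by rewrite /cross /dot; ring.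
by rewrite h1 h2 h12; apply/negP => /eqP; lra.
Qed.

(** The obstruction is an edge without vertices whose arc happens to start at [q]. Such an edge is a
    full circle, and starting half a turn away makes [q] an inner point. *)
Lemma inner_param q : support B q -> q \notin verts B -> exists e A s,
  [/\ is_edge_arc e A, 0 < s < arc_len A & q = arc_point A s].
Proof.
case=> e qe nv; have [A eA] := regular_curvature Breg e.
have [l0 hk imA endsA] := eA.
have := qe; rewrite imA => -[s]; rewrite /= in_itv /= => hs qs.
have [hsi|hsi] := boolP (0 < s < arc_len A); first by exists e, A, s.
have nv0 : curve e 0 \notin verts B.
  apply/negP => v0; have [h0 h1] := endsA v0.
  have v1 : curve e 1 \in verts B.
    by case: (curve_ends e) => [[]//|[_]]; rewrite v0.
  have [s0|s1] : s = 0 \/ s = arc_len A by lra.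
    by move: nv; rewrite -qs s0 h0 v0.
  by move: nv; rewrite -qs s1 h1 v1.
have full := closed_edge_circle eA nv0.
pose l := arc_len A; pose A' := arc_shift A (l / 2).
have per t : arc_point A (t + l) = arc_point A t by exact: arc_period.
have eA' : is_edge_arc e A'.
  split=> //; last by rewrite (negbTE nv0).
  rewrite imA; apply/seteqP; split=> x [t]; rewrite /= in_itv /= => ht <-.
    have [htl|htl] := lerP (l / 2) t.
      by exists (t - l / 2); rewrite /= ?in_itv /= ?arc_shift_point ?subrKC // /l in htl *; lra.
    exists (t + l / 2); first by rewrite /= in_itv /= /l in htl *; lra.
    by rewrite arc_shift_point -(per t); congr arc_point; rewrite /l; field.
  have [htl|htl] := lerP t (l / 2).
    by exists (l / 2 + t); rewrite /= ?in_itv /= ?arc_shift_point // /l in htl *; lra.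
  exists (t - l / 2); first by rewrite /= in_itv /= /l in htl *; lra.
  by rewrite arc_shift_point -(per (t - _)); congr arc_point; rewrite /l; field.
exists e, A', (l / 2); split=> //; first by rewrite /= /l; lra.
have -> : arc_point A' (l / 2) = arc_point A (0 + l).
  by rewrite arc_shift_point; congr arc_point; field.
rewrite -qs per; have [->//|->] : s = 0 \/ s = 0 + arc_len A by lra.
exact: per.
Qed.

End Local.

(** * Convexity of the faces *)

Section Convexity.
Variables (R : realType) (n : nat) (B : bubble_complex R n).
Hypothesis Breg : regular B.
Variable P : R.
Hypothesis P_gt0 : 0 < P.
Hypothesis pressureP : forall i : 'I_n, crossing_sum B (Some i) = [set P].
Implicit Types (p q u v w : R * R) (A : arc R) (e : edge B).

(** If [b > 0], the points of [E] near [q] have coordinates about [h * a] and [h * b] and fall into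
    the half-box of [F] for small [h]. *)
Lemma tangent_box (E F : set (R * R)) q d w (a b del : R) : cross d w != 0 ->
  0 < del -> (forall x y, `|x| < del -> 0 < y < del -> F (q + x *: d + y *: w)) ->
  (forall x, E x -> ~ F x) -> tangent_dir E q (a *: d + b *: w) -> b <= 0.
Proof.
move=> c0 del0 hF EF tE; rewrite leNgt; apply/negP => b0.
have eps0 : 0 < Num.min (b / 2) 1 by rewrite lt_min ltr01 andbT; lra.
have [d' d'0 hd'] := tangent_coords c0 tE eps0.
have K0 : 0 < `|a| + `|b| + 2 by rewrite ltr_wpDl // addr_ge0.
pose h := Num.min (d' / 2) (del / (`|a| + `|b| + 2)).
have h0 : 0 < h by rewrite lt_min divr_gt0 //= divr_gt0.
have hd : h < d' by rewrite gt_min; apply/orP; left; lra.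
have hK : h * (`|a| + `|b| + 2) <= del.
  by rewrite -ler_pdivlMr // ge_min lexx orbT.
have [a' [b' [ha hb Ex]]] := hd' h ltac:(lra).
move: ha hb; rewrite !lt_min => /andP[_ ha] /andP[hb hb1].
have b'0 : 0 < b' by move: hb; rewrite ltr_norml; lra.
have a'b : `|a'| < `|a| + 1.
  have -> : a' = (a' - a) + a by rewrite subrK.
  by apply: le_lt_trans (ler_normD _ _) _; lra.
have b'b : b' < `|b| + 1.
  have := ler_norm b; move: hb1; rewrite ltr_norml; lra.
have := normr_ge0 a; have := normr_ge0 b => na nb.
apply: (EF _ Ex); apply: hF.
  by rewrite normrM (gtr0_norm h0); nra.
by apply/andP; split; nra.
Qed.

(* The set [F] cannot lie on one side of a line through a point [q] of the
   graph while containing an open interval of this line ending at [q]: at a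
   vertex one of the three tangents would point into [F], and at an inner
   point of an edge the edge would have to be curved away from the interior
   region on its side. *)
Lemma no_touching (F : set (R * R)) i q d w (del : R) :
  (forall x, F x -> region B (Some i) x) -> support B q -> cross d w != 0 ->
  0 < del -> (forall x y, `|x| < del -> 0 < y < del -> F (q + x *: d + y *: w)) ->
  (forall x, - del < x < 0 -> F (q + x *: d)) -> False.
Proof.
move=> Fi Sq c0 del0 hF hF0.
have offS x : support B x -> ~ F x by move=> hx /Fi /region_support.
have offE e x : edge_set e x -> ~ F x by move=> hx; apply: offS; exists e.
have coord (D : R * R) : D = (cross D w / cross d w) *: d + (cross d D / cross d w) *: w.
  exact: basis_decomp.
have le0 e (D : R * R) : tangent_dir (edge_set e) q D -> cross d D / cross d w <= 0.
  by rewrite [X in tangent_dir _ _ X]coord; apply: tangent_box hF (@offE e).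
have [vq|nvq] := boolP (q \in verts B).
  have [d1 [d2 [d3 [D1 [D2 [D3 [_ _ [t1 t2 t3] [u1 u2 u3] [n12 n23 n31]]]]]]]] :=
    vertex_tangents Breg vq.
  have s0 := unit_sum0 u1 u2 u3 n12 n23 n31.
  (* The [w]-coordinates of the three tangents have sum zero and none is positive, so all vanish;
     then [D1] and [D2] would both be parallel to [d]. *)
  have cs : cross d D1 / cross d w + cross d D2 / cross d w + cross d D3 / cross d w = 0.
    rewrite -!mulrDl (_ : _ + _ + _ = cross d (D1 + D2 + D3)); last first.
      by rewrite /cross /=; ring.
    by rewrite s0 /cross /= !mulr0 subrr mul0r.
  have l1 := le0 _ _ t1; have l2 := le0 _ _ t2; have l3 := le0 _ _ t3.
  have z1 : cross d D1 / cross d w = 0 by lra.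
  have z2 : cross d D2 / cross d w = 0 by lra.
  move/eqP: (unit_cross_neq0 u1 u2 n12); apply.
  rewrite (coord D1) (coord D2) z1 z2 /cross /= /GRing.scale /=; ring.
have [e [A [s [eA hs qE]]]] := inner_param Breg Sq nvq.
have [l0 _ imA _] := eA.
set T := arc_tangent A s; set N := arc_normal A s; set k := arc_curv A.
have onA x : 0 < s + x < arc_len A -> edge_set e (arc_point A (s + x)).
  by move=> hx; rewrite imA; exists (s + x) => //=; rewrite in_itv /=; lra.
have m0 : 0 < Num.min s (arc_len A - s) by rewrite lt_min; lra.
have ons x : `|x| < Num.min s (arc_len A - s) -> edge_set e (arc_point A (s + x)).
  by rewrite lt_min !ltr_norml => hx; apply: onA; lra.
have tT (g : R) : g = 1 \/ g = -1 -> tangent_dir (edge_set e) q (g *: T).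
  move=> hg; rewrite qE; apply: (arc_tangent_dir hg m0) => h /andP[h0 hm].
  apply: ons; rewrite normrM (gtr0_norm h0).
  by case: hg => ->; rewrite ?normrN normr1 mul1r.
(* At an inner point both [T] and its opposite are tangent directions, so [T] is parallel to [d]. *)
have T0 : cross d T / cross d w = 0.
  have := le0 _ _ (tT 1 (or_introl erefl)); have := le0 _ _ (tT (-1) (or_intror erefl)).
  rewrite scale1r (_ : cross d (-1 *: T) = - cross d T) ?mulNr; first lra.
  by rewrite /cross /= /GRing.scale /=; ring.
have TE : T = (cross T w / cross d w) *: d.
  by rewrite {1}(coord T) T0 scale0r addr0.
set a := cross T w / cross d w in TE.
have NE := coord N; set a' := cross N w / cross d w in NE.
set b' := cross d N / cross d w in NE.
have TN : cross T N = 1 := cross_tangent_normal A s.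
have ab : a * b' * cross d w = 1.
  by rewrite -TN TE NE /cross /= /GRing.scale /=; ring.
have a0 : a != 0 by apply: contra_eq_neq ab => ->; rewrite !mul0r eq_sym oner_eq0.
have b0 : b' != 0 by apply: contra_eq_neq ab => ->; rewrite mulr0 mul0r eq_sym oner_eq0.
have ptE x : arc_point A (s + x) =
    q + (arc_sin k x * a + arc_cos k x * a') *: d + (arc_cos k x * b') *: w.
  rewrite arc_point_expand -qE -/T -/N -/k TE NE.
  by apply: pointP; rewrite /= /GRing.scale /=; ring.
(* A straight edge runs along the line itself; the sign of [x] sends it to the part of the line that
   lies in [F]. *)
have [k0|k0] := eqVneq k 0.
  pose h := Num.min (Num.min s (arc_len A - s) / 2) (del / (2 * `|a|)).
  have na : 0 < `|a| by rewrite normr_gt0.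
  have h0 : 0 < h by rewrite lt_min divr_gt0 //= divr_gt0 // mulr_gt0.
  have hm : h < Num.min s (arc_len A - s).
    by rewrite gt_min; apply/orP; left; lra.
  have hd : h * (2 * `|a|) <= del.
    by rewrite -ler_pdivlMr ?mulr_gt0 // ge_min lexx orbT.
  pose x := - Num.sg a * h.
  have xh : `|x| = h.
    by rewrite normrM normrN normr_sg a0 mul1r gtr0_norm.
  have xa : x * a = - (h * `|a|) by rewrite normrEsg /x; ring.
  have := ons x; rewrite xh => /(_ hm) /offE; apply.
  rewrite ptE /arc_sin /arc_cos k0 eqxx !mul0r addr0 scale0r addr0 xa.
  by apply: hF0; have : 0 < h * `|a| by [rewrite mulr_gt0]; lra.
(* A curved edge that turns towards [w] enters the half-box. *)
have [kb|kb] := ltP 0 (k * b').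
  have [d1 d10 hd1] := arc_small k (@ltr01 R).
  have K0 : 0 < 2 * `|a| + `|a'| + `|b'| + 1 by rewrite ltr_wpDl // !addr_ge0 // mulr_ge0.
  pose M := Num.min (Num.min s (arc_len A - s)) (Num.min d1 (pi / `|k|)).
  have nk : 0 < `|k| by rewrite normr_gt0.
  have M0 : 0 < M by rewrite !lt_min d10 divr_gt0 ?pi_gt0 // !andbT -lt_min.
  pose x := Num.min (M / 2) (del / (2 * (2 * `|a| + `|a'| + `|b'| + 1))).
  have x0 : 0 < x by rewrite lt_min divr_gt0 //= divr_gt0 // mulr_gt0.
  have xM : x < M by rewrite gt_min; apply/orP; left; lra.
  have xd : x * (2 * (2 * `|a| + `|a'| + `|b'| + 1)) <= del.
    by rewrite -ler_pdivlMr ?mulr_gt0 // ge_min lexx orbT.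
  have nx : `|x| = x by rewrite gtr0_norm.
  move: xM; rewrite !(lt_min x) -lt_min => /andP[xm /andP[xd1 xk]].
  have [] := hd1 x; rewrite nx // !mul1r => hS hC.
  set S := arc_sin k x in hS; set C := arc_cos k x in hC.
  have S2 : `|S| <= 2 * x.
    have -> : S = (S - x) + x by rewrite subrK.
    by apply: le_trans (ler_normD _ _) _; rewrite nx; lra.
  have Cb : 0 < C * b'.
    rewrite /C /arc_cos (negbTE k0).
    have -> : (1 - cos (k * x)) / k * b' = (1 - cos (k * x)) * (k * b') / k ^+ 2.
      by field.
    rewrite divr_gt0 ?exprn_even_gt0 //= mulr_gt0 // subr_gt0 lt_neqAle cos_le1 andbT.
    apply/negP => /eqP /cos_eq1 hc.
    have : k * x = 0.
      apply: hc; rewrite normrM nx mulrC -ltr_pdivlMr //.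
      by apply: lt_trans xk _; rewrite ltr_pM2r ?invr_gt0 //; have := pi_gt0 R; lra.
    by move/eqP; rewrite mulf_eq0 (negbTE k0) gt_eqF.
  have := ons x; rewrite nx => /(_ xm) /offE; apply; rewrite ptE -/S -/C.
  apply: hF.
    apply: le_lt_trans (ler_normD _ _) _; rewrite (normrM S) (normrM C).
    have := normr_ge0 a; have := normr_ge0 a'; have := normr_ge0 b' => n1 n2 n3.
    have : `|S| * `|a| <= 2 * x * `|a| by apply: ler_wpM2r.
    have : `|C| * `|a'| <= x * `|a'| by apply: ler_wpM2r.
    have : 0 <= x * `|a| by rewrite mulr_ge0 // ltW.
    have : 0 <= x * `|a'| by rewrite mulr_ge0 // ltW.
    have : 0 <= x * `|b'| by rewrite mulr_ge0 // ltW.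
    lra.
  rewrite Cb /=; apply: le_lt_trans (ler_norm _) _; rewrite (normrM C).
  have := normr_ge0 a; have := normr_ge0 a'; have := normr_ge0 b' => n1 n2 n3.
  have : `|C| * `|b'| <= x * `|b'| by apply: ler_wpM2r.
  have : 0 <= x * `|a| by rewrite mulr_ge0 // ltW.
  have : 0 <= x * `|a'| by rewrite mulr_ge0 // ltW.
  have : 0 <= x * `|b'| by rewrite mulr_ge0 // ltW.
  lra.
(* The remaining edge turns away from [w] and so bulges into [F], against the sign given by the
   pressure; [g] tells on which side of the oriented arc [w] lies. *)
pose g := Num.sg b'.
have hg : g = 1 \/ g = -1.
  rewrite /g; case: (ltgtP b' 0) b0 => // hb _; first by right; rewrite ltr0_sg.
  by left; rewrite gtr0_sg.
have gb : g * b' = `|b'| by rewrite normrEsg.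
have nb : 0 < `|b'| by rewrite normr_gt0.
have : 0 <= g * k.
  apply: (pressure_side Breg P_gt0 pressureP eA hs hg (i := i)) => m; rewrite -qE -/N -/T.
  pose K := `|g * a' + m * a| + `|b'| + 1.
  have K0 : 0 < K by rewrite ltr_wpDl // addr_ge0.
  exists (del / K); first by rewrite divr_gt0.
  move=> h /andP[h0]; rewrite ltr_pdivlMr // => hK; apply: Fi.
  have -> : q + h *: (g *: N + m *: T) =
      q + (h * (g * a' + m * a)) *: d + (h * (g * b')) *: w.
    by rewrite TE NE; apply: pointP; rewrite /= /GRing.scale /=; ring.
  have n1 := normr_ge0 (g * a' + m * a).
  rewrite gb; apply: hF.
    by rewrite normrM (gtr0_norm h0); move: hK; rewrite /K; nra.
  by rewrite mulr_gt0 //=; move: hK; rewrite /K; nra.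
have kb0 : k * b' < 0 by rewrite lt_neqAle kb mulf_neq0.
have : k * b' = g * k * `|b'| by rewrite normrEsg -/g; case: hg => ->; ring.
move=> hkb hgk; have : 0 <= k * b' by rewrite hkb mulr_ge0.
by rewrite leNgt kb0.
Qed.

End Convexity.

(** * From the local condition to global convexity *)

Section FaceConvex.
Variables (R : realType) (n : nat) (B : bubble_complex R n).
Hypothesis Breg : regular B.
Variable P : R.
Hypothesis P_gt0 : 0 < P.
Hypothesis pressureP : forall i : 'I_n, crossing_sum B (Some i) = [set P].
Implicit Types (p q u v w x y z : R * R).

(** A point off the graph has a box inside one region; a point of the component in this box
    identifies the region and is joined to [q] by a segment. *)
Lemma component_frontier i x0 q : closure (connected_component (region B i) x0) q ->
  ~ connected_component (region B i) x0 q -> support B q.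
Proof.
move=> cq nq; apply: contrapT => /region_exists[j hj].
have [e e0 he] := open_boxP (region_open (i := j)) hj.
have [y Fy [h1 h2]] := (closure_boxP _ q).1 cq _ e0.
have ji : j = i.
  by apply: (region_inj (he _ h1 h2)); exact: connected_component_sub Fy.
apply: nq; apply: (component_segment Fy) => r [t t01 ->]; rewrite -ji; apply: he.
  rewrite /= /GRing.scale /=.
  have -> : y.1 + t * (q.1 - y.1) - q.1 = (1 - t) * (y.1 - q.1) by ring.
  by apply: le_lt_trans h1; apply: ler_unit_norm; lra.
rewrite /= /GRing.scale /=.
have -> : y.2 + t * (q.2 - y.2) - q.2 = (1 - t) * (y.2 - q.2) by ring.
by apply: le_lt_trans h2; apply: ler_unit_norm; lra.
Qed.

Variables (i : 'I_n) (x0 : R * R).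
Let F := connected_component (region B (Some i)) x0.

Let F_open : open F.
Proof. by apply: component_open; exact: region_open. Qed.

Let F_region x : F x -> region B (Some i) x.
Proof. exact: connected_component_sub. Qed.

Lemma fst_cont : continuous (fun z : R * R => z.1).
Proof. by move=> z; exact: cvg_fst. Qed.

Lemma snd_cont : continuous (fun z : R * R => z.2).
Proof. by move=> z; exact: cvg_snd. Qed.

(* Sweep the triangle by the segments from [x] to the points of [yz]: the
   first one that leaves [F] touches the graph as in [no_touching]. *)
Lemma triangle_sweep x y z : segment x y `<=` F -> segment y z `<=` F ->
  cross (y - x) (z - y) != 0 -> segment x z `<=` F.
Proof.
move=> Fxy Fyz c0.
(* [G l t] is at fraction [l] of the segment from [x] to [y + t *: (z - y)]. *)
pose G (l t : R) : R * R := x + l *: (y - x) + (l * t) *: (z - y).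
pose I : set R := `[0, 1]%classic.
pose K : set (R * R) := [set c | I c.1 /\ I c.2 /\ ~ F (G c.1 c.2)].
suff K0 : K = set0.
  move=> r [t t01 ->]; apply: contrapT => nF.
  have : K (t, 1).
    split; first by rewrite /I /= in_itv.
    split; first by rewrite /I /= in_itv /= ler01 lexx.
    move=> hG; apply: nF; move: hG; congr F.
    by apply: pointP; rewrite /G /= /GRing.scale /=; ring.
  by rewrite K0.
apply/eqP/negPn/negP => /set0P Kne.
have Gc : continuous (fun c : R * R => G c.1 c.2).
  move=> c; apply: cvgD; first apply: cvgD; first exact: cvg_cst.
    by apply: cvgZr_tmp; exact: fst_cont.
  by apply: cvgZr_tmp; apply: cvgM; [exact: fst_cont | exact: snd_cont].
have Kc : compact K.
  rewrite (_ : K = (I `*` I) `&` ((fun c : R * R => G c.1 c.2) @^-1` ~` F)).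
    apply: compact_closedI.
      by apply: compact_setX; exact: segment_compact.
    by apply: closed_comp => [c _|]; [exact: Gc | exact: open_closedC].
  by apply/seteqP; split=> c /=; [case=> ? [? ?] | case=> -[? ?] ?].
(* Minimizing [t] and then [l] over the compact set [K] gives the first segment that leaves [F] and
   the first point where it does. *)
have [c1 /set_mem Kc1 min1] := compact_EVT_min Kne Kc
  (continuous_subspaceT snd_cont).
pose K' : set (R * R) := K `&` [set c | c.2 = c1.2].
have K'c : compact K'.
  apply: compact_closedI => //.
  have -> : [set c : R * R | c.2 = c1.2] = (fun c => c.2) @^-1` [set c1.2].
    by apply/seteqP; split.
  by apply: closed_comp => [c _|]; [exact: snd_cont | exact: closed_eq].
have [c2 /set_mem [Kc2 c21] min2] :=
  compact_EVT_min (ex_intro K' c1 (conj Kc1 erefl)) K'c (continuous_subspaceT fst_cont).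
case: c2 Kc2 c21 min2 => l t /= [Il [It nF]] tE min2.
move: Il It nF; rewrite /I /= !in_itv /= => /andP[l0 l1] /andP[t0 t1] nF.
have inF a b : 0 <= a <= 1 -> 0 <= b <= 1 -> b < t \/ b = t /\ a < l -> F (G a b).
  move=> ha hb hab; apply: contrapT => nFab.
  have Kab : K (a, b) by rewrite /K /I /= !in_itv /=.
  have := min1 (a, b) (mem_set Kab); rewrite /= -tE => htb.
  case: hab => [|[bt al]]; first by rewrite ltNge htb.
  have : K' (a, b) by split=> //=; rewrite bt.
  by move/mem_set/min2; rewrite /= leNgt al.
have l_gt0 : 0 < l.
  rewrite lt_neqAle l0 andbT; apply/eqP => lz; apply: nF.
  rewrite /G -lz mul0r !scale0r !addr0; apply: Fxy; exact: segment_l.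
have t_gt0 : 0 < t.
  rewrite lt_neqAle t0 andbT; apply/eqP => tz; apply: nF.
  by rewrite /G -tz mulr0 scale0r addr0; apply: Fxy; exists l => //; rewrite l0.
have l_lt1 : l < 1.
  rewrite lt_neqAle l1 andbT; apply/eqP => lz; apply: nF.
  apply: Fyz; exists t; first by rewrite t0.
  by rewrite /G lz; apply: pointP; rewrite /= /GRing.scale /=; ring.
(* [d] runs along this segment, and [w] points back to the part already swept. *)
pose d := (y - x) + t *: (z - y); pose w := y - z.
pose q := G l t.
have qE (a b : R) : - l < a -> q + a *: d + b *: w = G (l + a) (t - b / (l + a)).
  by move=> ha; apply: pointP; rewrite /q /G /d /w /= /GRing.scale /=; field; lra.
have qE0 (a : R) : q + a *: d = G (l + a) t.
  by apply: pointP; rewrite /q /G /d /= /GRing.scale /=; ring.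
(* As [l + a > l / 2], the bound [t * l / 2] on [b] gives [b / (l + a) < t]: the half-box consists
   of points already swept. *)
pose del := Num.min (l / 2) (Num.min (1 - l) (t * l / 2)).
have del0 : 0 < del.
  by rewrite !lt_min; apply/and3P; split; [lra | lra | rewrite divr_gt0 ?mulr_gt0].
have bel a : a < del -> [/\ a < l / 2, a < 1 - l & a < t * l / 2].
  by rewrite !lt_min => /and3P.
have left_ok a : - del < a < 0 -> F (q + a *: d).
  move=> /andP[ha a0]; rewrite qE0; apply: inF; [|lra|right; split=> //; lra].
  by have [] := bel (- a) ltac:(lra); lra.
apply: (no_touching Breg P_gt0 pressureP (F := F) (q := q) (d := d) (w := w) (del := del)) => //.
- exact: F_region.
- apply: (@component_frontier (Some i) x0) => //.
  apply/closure_boxP => e e0.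
  have nd : 0 < `|d.1| + `|d.2| + 1 by rewrite ltr_wpDl // addr_ge0.
  pose h := Num.min (del / 2) (e / (`|d.1| + `|d.2| + 1)).
  have h0 : 0 < h by rewrite lt_min !divr_gt0.
  have hd : h < del by rewrite gt_min; apply/orP; left; lra.
  have he : h * (`|d.1| + `|d.2| + 1) <= e.
    by rewrite -ler_pdivlMr // ge_min lexx orbT.
  have p1 : 0 <= h * `|d.1| by rewrite mulr_ge0 // ltW.
  have p2 : 0 <= h * `|d.2| by rewrite mulr_ge0 // ltW.
  exists (q + (- h) *: d); first by apply: left_ok; lra.
  by split; rewrite /= /GRing.scale /= addrC addKr normrM normrN (gtr0_norm h0); lra.
- rewrite (_ : cross d w = - cross (y - x) (z - y)) ?oppr_eq0 //.
  by rewrite /cross /d /w /= /GRing.scale /=; ring.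
- move=> a b ha /andP[b0 hb].
  have [a1 a2 _] := bel _ ha; have [_ _ b3] := bel _ hb.
  move: a1 a2; rewrite !ltr_norml => a1 a2.
  have la0 : 0 < l + a by lra.
  rewrite qE; last lra.
  have blt : b / (l + a) < t.
    rewrite ltr_pdivrMr //; apply: lt_trans b3 _; rewrite -mulrA ltr_pM2l //; lra.
  have bgt : 0 < b / (l + a) by rewrite divr_gt0.
  by apply: inF; [lra | lra | left; lra].
Qed.

(** In the collinear case [z = y + m *: (y - x)], and a point of the segment from [x] to [z] is on
    the first or the second given segment according to whether [t * (1 + m)] is in [0, 1]. *)
Lemma sweep x y z : segment x y `<=` F -> segment y z `<=` F -> segment x z `<=` F.
Proof.
move=> Fxy Fyz; have [c0|] := eqVneq (cross (y - x) (z - y)) 0; last first.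
  exact: triangle_sweep.
have [yx|yx] := eqVneq y x; first by move: Fyz; rewrite yx.
have [m zE] : exists m : R, z = y + m *: (y - x).
  have yx0 : y - x != 0 by rewrite subr_eq0.
  pose N := dot (y - x) (y - x); exists (dot (z - y) (y - x) / N).
  have N0 : N != 0.
    apply: contraNneq yx0 => hN; have : (y - x).1 ^+ 2 + (y - x).2 ^+ 2 = 0.
      by rewrite -[RHS]hN /N /dot; ring.
    move=> h; have [u1 u2] : (y - x).1 = 0 /\ (y - x).2 = 0.
      by move: h; move: (_.1) (_.2) => a b h; split; nra.
    by apply/eqP; exact: pointP.
  have e1 : N * (z - y).1 = dot (z - y) (y - x) * (y - x).1 -
      cross (y - x) (z - y) * (y - x).2 by rewrite /N /dot /cross; ring.
  have e2 : N * (z - y).2 = dot (z - y) (y - x) * (y - x).2 +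
      cross (y - x) (z - y) * (y - x).1 by rewrite /N /dot /cross; ring.
  rewrite c0 !mul0r subr0 in e1; rewrite c0 !mul0r addr0 in e2.
  apply: (addrI (- y)); rewrite addrA addNr add0r addrC.
  apply: pointP; apply: (mulfI N0); first rewrite e1; last rewrite e2.
    by rewrite /= /GRing.scale /=; field.
  by rewrite /= /GRing.scale /=; field.
move=> r [t /andP[t0 t1] ->].
have [h|h] := boolP (0 <= t * (1 + m) <= 1).
  apply: Fxy; exists (t * (1 + m)) => //; rewrite zE.
  by apply: pointP; rewrite /= /GRing.scale /=; ring.
have m0 : m != 0 by apply: contraNneq h => ->; rewrite addr0 mulr1 t0 t1.
apply: Fyz; exists ((t * (1 + m) - 1) / m); last first.
  by rewrite zE; apply: pointP; rewrite /= /GRing.scale /=; field.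
have [mp|mn|/eqP] := ltgtP 0 m; last by rewrite eq_sym (negbTE m0).
  have tm0 : 0 <= t * (1 + m) by apply: mulr_ge0 => //; lra.
  have h1 : 1 < t * (1 + m) by rewrite ltNge; move: h; rewrite tm0.
  have h2 : 0 <= (1 - t) * (1 + m) by apply: mulr_ge0; lra.
  by rewrite divr_ge0 ?ler_pdivrMr /=; lra.
have h1 : t * (1 + m) < 0.
  rewrite ltNge; apply/negP => tm0; move: h; rewrite tm0 /= -ltNge => h1.
  have [m1|m1] := lerP 0 (1 + m).
    by have : 0 <= (1 - t) * (1 + m) by [apply: mulr_ge0; lra]; lra.
  by have : 0 <= t * - (1 + m) by [apply: mulr_ge0; lra]; lra.
have m1 : 1 + m < 0.
  rewrite ltNge; apply/negP => m1.
  by have : 0 <= t * (1 + m) by [apply: mulr_ge0]; lra.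
have h2 : 0 <= (1 - t) * - (1 + m) by apply: mulr_ge0; lra.
rewrite -mulrNN -invrN divr_ge0 ?ler_pdivrMr /=; lra.
Qed.

(** The points that [x] sees inside [F] form an open and relatively closed part of the connected set
    [F], since [sweep] absorbs a short segment appended in a box. *)
Lemma face_convex : segment_convex F.
Proof.
move=> x z Fx Fz.
pose S := [set z | F z /\ segment x z `<=` F].
suff SF : S = F by have : S z by [rewrite SF]; case.
have move_in p q (e : R) : F p -> (forall r, `|r.1 - p.1| < e -> `|r.2 - p.2| < e -> F r) ->
    `|q.1 - p.1| < e -> `|q.2 - p.2| < e -> segment p q `<=` F /\ segment q p `<=` F.
  move=> Fp he h1 h2; split=> r [t t01 ->]; apply: he; rewrite /= /GRing.scale /=.
  - by rewrite addrC addKr; apply: le_lt_trans h1; exact: ler_unit_norm.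
  - by rewrite addrC addKr; apply: le_lt_trans h2; exact: ler_unit_norm.
  - have -> : q.1 + t * (p.1 - q.1) - p.1 = (1 - t) * (q.1 - p.1) by ring.
    by apply: le_lt_trans h1; apply: ler_unit_norm; lra.
  - have -> : q.2 + t * (p.2 - q.2) - p.2 = (1 - t) * (q.2 - p.2) by ring.
    by apply: le_lt_trans h2; apply: ler_unit_norm; lra.
apply: (component_connected (A := region B (Some i)) (x := x0)).
- exists x; split=> // r [t _ ->]; by rewrite subrr scaler0 addr0.
- exists S; last by apply/seteqP; split=> [p [? ?]|p []].
  apply: open_boxI => p [Fp Sp]; have [e e0 he] := open_boxP F_open Fp.
  exists e => // q h1 h2; split; first exact: he.
  by apply: (sweep Sp); have [] := move_in _ _ _ Fp he h1 h2.
- exists (closure S); first exact: closed_closure.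
  apply/seteqP; split=> [p Sp|p [Fp cSp]].
    by split; [exact: Sp.1 | exact: subset_closure].
  have [e e0 he] := open_boxP F_open Fp.
  have [q [Fq Sq] [h1 h2]] := (closure_boxP _ p).1 cSp _ e0.
  split=> //; apply: (sweep Sq).
  by have [] := move_in _ _ _ Fp he h1 h2.
Qed.

End FaceConvex.

(** * Corners of a face *)

Section Corners.
Variables (R : realType) (n : nat) (B : bubble_complex R n).
Hypothesis Breg : regular B.
Implicit Types (p q u v w D : R * R).

(** The limit [t -> 0]: with [convex_closure_open] it extends linear inequalities from [F] to its
    closure. *)
Lemma lin_closure (a b c : R) :
  (forall t, 0 < t <= 1 -> a + t * (b - a) <= c) -> a <= c.
Proof.
move=> h; rewrite leNgt; apply/negP => ca.
have K0 : 0 < `|b - a| + (a - c) by rewrite ltr_wpDl // subr_gt0.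
pose t := (a - c) / (2 * (`|b - a| + (a - c))).
have t0 : 0 < t by rewrite divr_gt0 ?subr_gt0 // mulr_gt0.
have tK : t * (2 * (`|b - a| + (a - c))) = a - c by rewrite divfK // gt_eqF // mulr_gt0.
have t1 : t <= 1.
  by rewrite ler_pdivrMr ?mulr_gt0 // mul1r; have := normr_ge0 (b - a); lra.
have := h t; rewrite t0 t1 => /(_ isT).
have : t * - (b - a) <= t * `|b - a|.
  by rewrite ler_wpM2l ?(ltW t0) // -normrN ler_norm.
have : 0 < t * (a - c) by rewrite mulr_gt0 // subr_gt0.
lra.
Qed.

Section Sector.
Variables (F : set (R * R)) (f : R * R) (v D1 D2 : R * R).
Hypotheses (oF : open F) (cF : segment_convex F) (Ff : F f).
Hypothesis c0 : cross D1 D2 != 0.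
Hypothesis sec : in_sector F v D1 D2.

Lemma sector_closure (a b : R) : closure F (v + a *: D1 + b *: D2) -> 0 <= a /\ 0 <= b.
Proof.
move=> cx; have [a1 [b1 [a10 b10 fE]]] := sec Ff.
have key t : 0 < t <= 1 -> 0 < a + t * (a1 - a) /\ 0 < b + t * (b1 - b).
  move=> ht; have := convex_closure_open oF cF Ff cx ht.
  rewrite fE => /sec[a2 [b2 [a20 b20 h]]].
  have h1 : (a2 - (a + t * (a1 - a))) *: D1 + (b2 - (b + t * (b1 - b))) *: D2 = 0.
    apply: (addrI v); rewrite addr0.
    transitivity ((v + a2 *: D1 + b2 *: D2) -
      ((v + a *: D1 + b *: D2) + t *: ((v + a1 *: D1 + b1 *: D2) - (v + a *: D1 + b *: D2))) + v).
      by apply: pointP; rewrite /= /GRing.scale /=; ring.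
    by rewrite -h subrr add0r.
  have z1 : a2 - (a + t * (a1 - a)) = 0.
    apply: (mulIf c0); rewrite mul0r.
    transitivity (cross ((a2 - (a + t * (a1 - a))) *: D1 + (b2 - (b + t * (b1 - b))) *: D2) D2).
      by rewrite /cross /= /GRing.scale /=; ring.
    by rewrite h1 /cross /=; ring.
  have z2 : b2 - (b + t * (b1 - b)) = 0.
    apply: (mulIf c0); rewrite mul0r.
    transitivity (cross D1 ((a2 - (a + t * (a1 - a))) *: D1 + (b2 - (b + t * (b1 - b))) *: D2)).
      by rewrite /cross /= /GRing.scale /=; ring.
    by rewrite h1 /cross /=; ring.
  by split; lra.
split; rewrite -oppr_le0; [apply: (@lin_closure _ (- a1)) | apply: (@lin_closure _ (- b1))];
  by move=> t /key; lra.
Qed.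

(** Both coordinates are negative along this direction, whereas the closure of [F] is in the closed
    sector. *)
Lemma sector_third (E : set (R * R)) : tangent_dir E v (- D1 - D2) ->
  E `<=` closure F -> False.
Proof.
have -> : - D1 - D2 = (-1) *: D1 + (-1) *: D2.
  by apply: pointP; rewrite /= /GRing.scale /=; ring.
move=> tE EF; have e0 : 0 < 1 / 2 :> R by lra.
have [d d0 hd] := tangent_coords c0 tE e0.
have [a [b [ha _ /EF /sector_closure[h _]]]] := hd (d / 2) ltac:(lra).
have : a < 0 by move: ha; rewrite ltr_norml; lra.
have : 0 < d / 2 by lra.
by nra.
Qed.

Lemma sector_corner : dot D1 D1 = 1 -> dot D2 D2 = 1 -> dot D1 D2 = - (1 / 2) ->
  exists2 D, dot D D = 1 & corner (closure F) v D.
Proof.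
move=> h1 h2 h12.
have decomp x : x = v + (cross (x - v) D2 / cross D1 D2) *: D1 +
    (cross D1 (x - v) / cross D1 D2) *: D2.
  by rewrite -addrA -basis_decomp // addrC subrK.
have [D2E|D1E] := rot_pair h1 h2 h12.
  exists D1 => // x cx; rewrite (decomp x) in cx *.
  have [a0 b0] := sector_closure cx.
  by rewrite -D2E; do 2 eexists; split; [exact: a0 | exact: b0 |].
exists D2 => // x cx; rewrite (decomp x) in cx *.
have [a0 b0] := sector_closure cx.
by rewrite -D1E; do 2 eexists; split; [exact: b0 | exact: a0 | rewrite addrAC].
Qed.

End Sector.

(** The three tangent rays avoid [F] because the edges do, so one sector contains [F], and
    [sector_third] rules out the edge-end opposite to it. *)
Lemma face_corner (F : set (R * R)) f v : open F -> segment_convex F -> F f ->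
  (forall x, support B x -> ~ F x) -> v \in verts B -> closure F v ->
  (exists2 D, dot D D = 1 & corner (closure F) v D) /\
  (#|[pred d : edge B * bool | `[< bounds d.1 F >] && (edge_end d == v)]| <= 2)%N.
Proof.
move=> oF cF Ff offS vB cv.
have [d1 [d2 [d3 [D1 [D2 [D3 [[all3 _] [e1 e2 e3] [t1 t2 t3] [u1 u2 u3] [a12 a23 a31]]]]]]]] :=
  vertex_tangents Breg vB.
have offE (e : edge B) x : edge_set e x -> ~ F x by move=> hx; apply: offS; exists e.
have Fv : ~ F v.
  apply: (offE d1.1); rewrite -e1 /edge_end; exists (d1.2)%:R => //=.
  by rewrite in_itv /=; case: (d1.2); rewrite /= ?ler01 ?lexx.
have n1 h := tangent_avoid (h := h) oF cF cv (@offE _) t1.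
have n2 h := tangent_avoid (h := h) oF cF cv (@offE _) t2.
have n3 h := tangent_avoid (h := h) oF cF cv (@offE _) t3.
have s0 := unit_sum0 u1 u2 u3 a12 a23 a31.
have c12 := unit_cross_neq0 u1 u2 a12.
have c23 := unit_cross_neq0 u2 u3 a23.
have c31 := unit_cross_neq0 u3 u1 a31.
have main (da db dc : edge B * bool) (Da Db Dc : R * R) : in_sector F v Da Db -> cross Da Db != 0 ->
    dot Da Da = 1 -> dot Db Db = 1 -> dot Da Db = - (1 / 2) -> Dc = - Da - Db ->
    tangent_dir (edge_set dc.1) v Dc ->
    (forall d, edge_end d = v -> d \in [:: da; db; dc]) ->
    (exists2 D, dot D D = 1 & corner (closure F) v D) /\
    (#|[pred d : edge B * bool | `[< bounds d.1 F >] && (edge_end d == v)]| <= 2)%N.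
  move=> sec c0 h1 h2 h12 DcE tc hall; split; first exact: (sector_corner oF cF Ff c0 sec h1 h2 h12).
  rewrite DcE in tc.
  apply: (@leq_trans #|[:: da; db]|); last exact: card_size.
  apply: subset_leq_card.
  apply/fintype.subsetP => d; rewrite inE => /andP[/asboolP bd /eqP hd].
  have := hall _ hd; rewrite !inE orbA => /orP[//|/eqP dE].
  by exfalso; rewrite dE in bd; apply: (sector_third oF cF Ff c0 sec tc bd).
have D3E : D3 = - D1 - D2 by rewrite -[LHS](addKr (D1 + D2)) s0 addr0 opprD.
have D1E : D1 = - D2 - D3.
  by apply: (addIr (D2 + D3)); rewrite addrA s0 -opprD addNr.
have D2E : D2 = - D3 - D1.
  by apply: (addIr (D3 + D1)); rewrite addrCA addrA addrAC -addrA addrC s0 -opprD addNr.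
have [sec|sec|sec] := sector_trichotomy cF c12 s0 Ff Fv n1 n2 n3.
- exact: (main d1 d2 d3 _ _ _ sec c12 u1 u2 a12 D3E t3 all3).
- apply: (main d2 d3 d1 _ _ _ sec c23 u2 u3 a23 D1E t1) => d /all3.
  by rewrite !inE => /or3P[] ->; rewrite ?orbT.
- apply: (main d3 d1 d2 _ _ _ sec c31 u3 u1 a31 D2E t2) => d /all3.
  by rewrite !inE => /or3P[] ->; rewrite ?orbT.
Qed.

Lemma card_fibers (T : finType) (U : eqType) (f : T -> U) (V : seq U) (c : nat) :
  forall Q : pred T, (forall x, Q x -> f x \in V) ->
  (forall y, y \in V -> (#|[pred x | Q x && (f x == y)]| <= c)%N) ->
  (#|Q| <= c * size V)%N.
Proof.
elim: V => [|y V IH] Q hf hc.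
  rewrite muln0 leqn0; apply/eqP/eq_card0 => x; rewrite unfold_in.
  by apply/negP => /hf.
rewrite -(cardID [pred x | f x == y] Q) /= mulnS leq_add //.
  apply: leq_trans (hc y (mem_head _ _)); apply: subset_leq_card.
  by apply/fintype.subsetP => x; rewrite !inE => /andP[xf xQ]; apply/andP; split.
apply: IH => [x|z zV].
  rewrite !inE => /andP[xy xQ]; have := hf x xQ.
  by rewrite inE (negbTE xy).
have zV' : z \in y :: V by rewrite inE zV orbT.
apply: leq_trans (hc z zV'); apply: subset_leq_card.
by apply/fintype.subsetP => x; rewrite !inE => /andP[/andP[_ xQ] xz]; apply/andP; split.
Qed.

End Corners.

(** * Closed edges *)

Section ClosedEdge.
Variables (R : realType) (n : nat) (B : bubble_complex R n).
Implicit Types (p q u v w D : R * R) (A : arc R) (e : edge B).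

Lemma cos_sin_int_period (x : R) (z : int) :
  cos (x + 2 * pi * z%:~R) = cos x /\ sin (x + 2 * pi * z%:~R) = sin x.
Proof.
have pos (y : R) (m : nat) : cos (y + 2 * pi * m%:R) = cos y /\ sin (y + 2 * pi * m%:R) = sin y.
  have -> : 2 * pi * m%:R = (pi *+ 2) *+ m :> R by rewrite -[RHS]mulr_natr mulr2n; ring.
  by rewrite (periodicn (@cosD2pi R)) (periodicn (@sinD2pi R)).
case: z => m; first exact: pos.
have := pos (x + 2 * pi * (Negz m)%:~R) m.+1.
rewrite NegzE -addrA -mulrDr -[m.+1%:R]/((m.+1%:Z)%:~R) -intrD addNr mulr0 addr0.
by case=> -> ->.
Qed.

Lemma unit_angle D : dot D D = 1 -> exists x : R, D = (cos x, sin x).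
Proof.
case: D => a b; rewrite /dot /= => h.
have ha : -1 <= a <= 1 by apply/andP; split; nra.
have hb : b ^+ 2 = 1 - a ^+ 2 by rewrite -h; ring.
have sE : sin (acos a) = `|b| by rewrite sin_acos // -hb sqrtr_sqr.
have cE : cos (acos a) = a by rewrite acosK // in_itv.
have [b0|b0] := lerP 0 b.
  by exists (acos a); rewrite sE cE ger0_norm.
by exists (- acos a); rewrite cosN sinN sE cE ltr0_norm // opprK.
Qed.

Lemma sgr_pm1 (x : R) : x != 0 -> Num.sg x = 1 \/ Num.sg x = -1.
Proof.
case: (ltgtP x 0) => // hx _; first by right; rewrite ltr0_sg.
by left; rewrite gtr0_sg.
Qed.

Lemma circle_onto A D : `|arc_curv A| * arc_len A = 2 * pi -> dot D D = 1 ->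
  exists2 s, 0 <= s <= arc_len A & arc_normal A s = D.
Proof.
move=> full uD; have p0 := pi_gt0 R.
set k := arc_curv A in full *; set l := arc_len A in full *.
have k0 : k != 0.
  by apply/eqP => k0; move: full; rewrite k0 normr0 mul0r; lra.
have nk : 0 < `|k| by rewrite normr_gt0.
have [x xE] : exists x : R, D = (- sin x, cos x).
  have [|x] := @unit_angle (D.2, - D.1).
    by rewrite -uD /dot /=; ring.
  by case=> h1 h2; exists x; apply: pointP; rewrite /= -?h1 -?h2 ?opprK.
pose g := Num.sg k; pose th := arc_dir A.
have gg : g * g = 1 by rewrite /g -expr2 sqr_sg k0.
(* [z] counts the full turns to be removed from the angle of [D], and [g] is the direction in which
   the circle is traversed. *)
pose z := Num.floor (g * (x - th) / (2 * pi)).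
pose y := g * (x - th) - 2 * pi * z%:~R.
have tp : 0 < 2 * pi :> R by lra.
have y0 : 0 <= y.
  rewrite subr_ge0 mulrC -ler_pdivlMr //; exact: floor_le.
have y1 : y <= 2 * pi.
  have : g * (x - th) / (2 * pi) < (z + 1)%:~R by exact: floorD1_gt.
  by rewrite ltr_pdivrMr // intrD mulrDl mul1r /y; lra.
exists (y / `|k|).
  by rewrite divr_ge0 //= ler_pdivrMr // mulrC full.
have ks : k * (y / `|k|) = g * y.
  have kE : k = g * `|k| by exact: numEsg.
  by rewrite {1}kE -mulrA [`|k| * _]mulrC divfK // gt_eqF.
have [w wE] : exists w : int, th + g * y = x + 2 * pi * w%:~R.
  have hg : g = 1 \/ g = -1 by exact: sgr_pm1.
  case: hg => hg.
    by exists (- z); rewrite /y hg intrN; ring.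
  by exists z; rewrite /y hg; ring.
rewrite /arc_normal -/k -/th ks wE.
by have [-> ->] := cos_sin_int_period x w.
Qed.

(* The face inside a closed edge is the open disc bounded by this edge, whose
   closure contains no other edge. *)
Lemma closed_edge_alone (F : set (R * R)) f (e e' : edge B) : regular B ->
  open F -> segment_convex F -> F f -> (forall x, support B x -> ~ F x) ->
  curve e 0 \notin verts B -> bounds e F -> bounds e' F -> e' = e.
Proof.
move=> Breg oF cF Ff offS nv be be'.
have [A eA] := regular_curvature Breg e.
have full := closed_edge_circle eA nv; have [_ _ imA _] := eA.
have k0 : arc_curv A != 0.
  by apply/eqP => k0; move: full; rewrite k0 normr0 mul0r; have := pi_gt0 R; lra.
pose c := arc_center A; pose rho := `|(arc_curv A)^-1|.
have rho0 : 0 < rho by rewrite normr_gt0 invr_eq0.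
have onE D : dot D D = 1 -> edge_set e (c + rho *: D).
  move=> uD; pose g := Num.sg (arc_curv A)^-1.
  have hg : g = 1 \/ g = -1.
    by apply: sgr_pm1; rewrite invr_eq0.
  have [|s hs sE] := circle_onto (D := (- g) *: D) full.
    by rewrite dotZl dotZr uD; case: hg => ->; ring.
  rewrite imA; exists s; first by rewrite /= in_itv.
  rewrite arc_point_center // sE -/c [X in _ - X *: _]numEsg -/g -/rho.
  by apply: pointP; rewrite /= /GRing.scale /=; case: hg => ->; ring.
pose sq x := dot (x - c) (x - c).
have onsq x : sq x = rho ^+ 2 -> edge_set e x.
  move=> hx; have -> : x = c + rho *: (rho^-1 *: (x - c)).
    by rewrite scalerA divff ?gt_eqF // scale1r addrC subrK.
  by apply: onE; rewrite dotZl dotZr -/(sq x) hx; field; rewrite gt_eqF.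
have offE x : edge_set e x -> ~ F x by move=> hx; apply: offS; exists e.
have inside x : F x -> sq x < rho ^+ 2.
  move=> Fx; rewrite lt_neqAle; apply/andP; split.
    by apply/eqP => /onsq /offE.
  rewrite leNgt; apply/negP => hx.
  (* If [x] is outside the disc, the segment to [x] from [c + rho *: - D], which is in the closure
     of [F], passes through [c + rho *: D], and this point of the edge would be in [F]. *)
  pose d := Num.sqrt (sq x).
  have sq0 : 0 < sq x by apply: le_lt_trans hx; rewrite exprn_ge0 // ltW.
  have d0 : 0 < d by rewrite sqrtr_gt0.
  have d2 : d ^+ 2 = sq x by rewrite sqr_sqrtr // ltW.
  have rd : rho < d by rewrite -(ltr_pXn2r (n := 2)) ?nnegrE ?(ltW d0) ?(ltW rho0) // d2.
  pose D := d^-1 *: (x - c).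
  have uD : dot D D = 1 by rewrite dotZl dotZr -/(sq x) -d2; field; rewrite gt_eqF.
  apply: (offE _ (onE _ uD)).
  have uD' : dot (- D) (- D) = 1 by rewrite -uD /dot /=; ring.
  have -> : c + rho *: D = (c + rho *: - D) +
      (2 * rho / (d + rho)) *: (x - (c + rho *: - D)).
    by apply: pointP; rewrite /D /= /GRing.scale /=; field; lra.
  apply: convex_closure_open => //; first exact: be (onE _ uD').
  by rewrite divr_gt0 ?mulr_gt0 ?addr_gt0 //= ler_pdivrMr ?addr_gt0 // mul1r; lra.
have closure_in z : closure F z -> ~ edge_set e z -> F z.
  move=> cz nz.
  have sqz : sq z < rho ^+ 2.
    rewrite lt_neqAle; apply/andP; split; first by apply/eqP => /onsq.
    apply: (@lin_closure _ _ (sq z + 2 * dot (z - c) (f - z))) => t ht.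
    have := inside _ (convex_closure_open oF cF Ff cz ht).
    have : 0 <= t ^+ 2 * dot (f - z) (f - z).
      by rewrite mulr_ge0 ?sqr_ge0 // /dot -!expr2 addr_ge0 ?sqr_ge0.
    have -> : sq (z + t *: (f - z)) =
      sq z + t * (2 * dot (z - c) (f - z)) + t ^+ 2 * dot (f - z) (f - z).
      by rewrite /sq /dot /= /GRing.scale /=; ring.
    lra.
  have [<-//|fz] := eqVneq f z.
  (* The ray from [f] through [z] is continued to a point [y] of the circle: [t] is the positive
     root of [a * t ^+ 2 + 2 * b * t = cc]. Then [z] is strictly between [y], in the closure of [F],
     and [f]. *)
  pose a := dot (z - f) (z - f); pose b := dot (z - c) (z - f).
  have a0 : 0 < a.
    rewrite lt_neqAle /a /dot -!expr2 addr_ge0 ?sqr_ge0 // andbT.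
    apply: contraNneq fz => h.
    have [u1 u2] : (z - f).1 = 0 /\ (z - f).2 = 0.
      by move: h; move: (_.1) (_.2) => x y h; split; nra.
    by rewrite eq_sym -subr_eq0; apply/eqP; exact: pointP.
  pose cc := rho ^+ 2 - sq z; have cc0 : 0 < cc by rewrite subr_gt0.
  pose dd := Num.sqrt (b ^+ 2 + a * cc).
  have dd2 : dd ^+ 2 = b ^+ 2 + a * cc.
    by rewrite sqr_sqrtr // addr_ge0 ?sqr_ge0 // mulr_ge0 ?ltW.
  have ddb : b < dd.
    apply: le_lt_trans (ler_norm _) _.
    rewrite -(ltr_pXn2r (n := 2)) ?nnegrE ?sqrtr_ge0 // dd2 real_normK ?num_real //.
    by rewrite ltrDl mulr_gt0.
  pose t := (dd - b) / a.
  have t0 : 0 < t by rewrite divr_gt0 // subr_gt0.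
  have ta : t * a = dd - b by rewrite divfK // gt_eqF.
  pose y := z + t *: (z - f).
  have ye : edge_set e y.
    apply: onsq.
    have -> : sq y = sq z + 2 * t * b + t ^+ 2 * a.
      by rewrite /sq /y /a /b /dot /= /GRing.scale /=; ring.
    apply: (mulfI (x := a)); first by rewrite gt_eqF.
    have -> : a * (sq z + 2 * t * b + t ^+ 2 * a) =
      a * sq z + 2 * (t * a) * b + (t * a) ^+ 2 by ring.
    rewrite ta; have -> : a * sq z + 2 * (dd - b) * b + (dd - b) ^+ 2 =
      a * sq z + dd ^+ 2 - b ^+ 2 by ring.
    by rewrite dd2 /cc; ring.
  have -> : z = y + (t / (1 + t)) *: (f - y).
    by apply: pointP; rewrite /y /= /GRing.scale /=; field; lra.
  apply: convex_closure_open => //; first exact: be.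
  by rewrite divr_gt0 ?ler_pdivrMr //=; lra.
apply/eqP/negPn/negP => ee.
have h0 : edge_set e' (curve e' 0) by exists 0 => //=; rewrite in_itv /= lexx ler01.
(* A point of [e'] on [e] would be a vertex, and [e] carries none; otherwise it is in [F], which
   misses the graph. *)
have [he|he] := pselect (edge_set e (curve e' 0)).
  have [t ht hc] := he; rewrite /= in_itv /= in ht.
  have e01 : curve e 0 = curve e 1 /\ curve e 0 \notin verts B.
    by case: (curve_ends e) => // -[h _]; rewrite h in nv.
  have : curve e' 0 \in verts B.
    by apply: (curve_disjoint ee _ ht (esym hc)); rewrite lexx ler01.
  rewrite -hc; have [t0|t0] := eqVneq t 0; first by rewrite t0 (negbTE nv).
  have [t1|t1] := eqVneq t 1; first by rewrite t1 -e01.1 (negbTE nv).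
  by apply/negP; apply: curve_inner; rewrite lt_neqAle; [rewrite eq_sym t0 | rewrite t1]; lra.
have : support B (curve e' 0) by exists e'.
by move/offS; apply; apply: closure_in he; exact: be'.
Qed.

End ClosedEdge.

(** * Edges shared with the exterior *)

(** On the open parameter interval the arc is injective even if it is a full circle, where only the
    two ends coincide. *)
Lemma arc_preimage_finite (R : realType) (A : arc R) (W : set (R * R)) :
  `|arc_curv A| * arc_len A <= 2 * pi -> finite_set W ->
  finite_set [set s | 0 < s < arc_len A /\ W (arc_point A s)].
Proof.
move=> hk fW; pose g s := if 0 < s < arc_len A then Some (arc_point A s) else None.
apply: (@sub_finite_set _ _ (g @^-1` (Some @` W))).
  by move=> s [hs Ws] /=; exists (arc_point A s) => //; rewrite /g hs.
apply: finite_preimage; last exact: finite_image.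
move=> s t /set_mem [p _]; rewrite /g; case: ifP => // hs _ /set_mem [p' _].
rewrite /g; case: ifP => // ht _ [].
apply: arc_point_inj.
have [->|k0] := eqVneq (arc_curv A) 0.
  by rewrite normr0 mul0r mulr_gt0 ?pi_gt0.
apply: lt_le_trans hk; rewrite ltr_pM2l ?normr_gt0 // ltr_norml; lra.
Qed.

Lemma convex_weight (R : realFieldType) (a b : R) : 0 < a -> 0 <= b ->
  0 < a / (a + b) <= 1.
Proof. by move=> a0 b0; rewrite divr_gt0 ?ler_pdivrMr //=; lra. Qed.

Lemma le_add_lt (R : realDomainType) (a b c d m : R) :
  a <= c -> b <= d -> c + d < m -> a + b < m.
Proof. lra. Qed.

Lemma lt_add_double (R : realDomainType) (a b r : R) :
  a < r -> b < r -> a + b < 2 * r.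
Proof. lra. Qed.

Section ExteriorEdge.
Variables (R : realType) (n : nat) (B : bubble_complex R n).
Variable P : R.
Hypothesis P_gt0 : 0 < P.
Hypothesis pressureP : forall i : 'I_n, crossing_sum B (Some i) = [set P].
Implicit Types (p q u v w D : R * R).
Variables (F : set (R * R)) (f : R * R) (i : 'I_n).
Hypotheses (oF : open F) (cF : segment_convex F) (Ff : F f).
Hypothesis Fi : forall x, F x -> region B (Some i) x.
Variables (e : edge B) (A : arc R).
Hypotheses (eA : is_edge_arc e A) (eF : bounds e F).

Let offE x : edge_set e x -> ~ F x.
Proof. by move=> ex /Fi /region_support; apply; exists e. Qed.

Let onE s : 0 <= s <= arc_len A -> edge_set e (arc_point A s).
Proof. by case: eA => _ _ -> _ hs; exists s => //=; rewrite in_itv. Qed.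

Let arc_closure s : 0 <= s <= arc_len A -> closure F (arc_point A s).
Proof. by move=> /onE /eF. Qed.

(* A point of [F] on the convex side of the tangent at [arc_point A s] would
   form with two points of the arc a triangle around [arc_point A s]. *)
Lemma arc_support_line s x : arc_curv A != 0 -> 0 < s < arc_len A -> F x ->
  0 <= arc_curv A * dot (x - arc_point A s) (arc_normal A s).
Proof.
move=> k0 hs Fx; set k := arc_curv A in k0 *; rewrite leNgt; apply/negP => kb.
have qe : edge_set e (arc_point A s) by apply: onE; lra.
set q := arc_point A s in kb qe *.
set N := arc_normal A s in kb *; pose T := arc_tangent A s.
set b := dot _ N in kb *; pose a := dot (x - q) T.
have b0 : 0 < `|b| by rewrite normr_gt0; apply: contraTneq kb => ->; rewrite mulr0 ltxx.
have K0 : 0 < `|a| + `|b| by rewrite ltr_wpDl.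
(* With this [eps] the height [C] of the chord is small enough compared with its half-length [S]
   that the line from [x] through [q] hits the chord between its ends: this is [aC] below. *)
pose eps := `|b| / (2 * (`|a| + `|b|)).
have eps0 : 0 < eps by rewrite divr_gt0 // mulr_gt0.
have epsK : eps * (2 * (`|a| + `|b|)) = `|b| by rewrite divfK // gt_eqF // mulr_gt0.
have eps1 : eps <= 1 / 2.
  by rewrite ler_pdivrMr ?mulr_gt0 //; have := normr_ge0 a; lra.
have [d d0 hd] := arc_small k eps0.
have nk : 0 < `|k| by rewrite normr_gt0.
pose M := Num.min (Num.min s (arc_len A - s)) (Num.min d (pi / `|k|)).
have M0 : 0 < M.
  by rewrite !lt_min d0 divr_gt0 ?pi_gt0 // !andbT; lra.
pose h := M / 2; have h0 : 0 < h by rewrite divr_gt0.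
have : h < M by rewrite /h; lra.
rewrite !lt_min => /andP[/andP[hs1 hs2] /andP[hd1 hk1]].
have ch1 : closure F (arc_point A (s + h)) by apply: arc_closure; lra.
have ch2 : closure F (arc_point A (s + - h)) by apply: arc_closure; lra.
have nh : `|h| = h by rewrite gtr0_norm.
have [] := hd h; rewrite nh // => hS hC.
set S := arc_sin k h in hS; set C := arc_cos k h in hC.
have S0 : h / 2 <= S.
  have : eps * h <= 1 / 2 * h by rewrite ler_wpM2r // ltW.
  by move: hS; rewrite ler_norml; lra.
have Sp : 0 < S by lra.
have kC : 0 < k * C.
  rewrite /C /arc_cos (negbTE k0) mulrC divfK // subr_gt0 lt_neqAle cos_le1 andbT.
  apply/negP => /eqP /cos_eq1 hc.
  have : k * h = 0.
    apply: hc; rewrite normrM nh mulrC -ltr_pdivlMr //.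
    by apply: lt_trans hk1 _; rewrite ltr_pM2r ?invr_gt0 //; have := pi_gt0 R; lra.
  by move/eqP; rewrite mulf_eq0 (negbTE k0) gt_eqF.
have C0 : C != 0 by apply: contraTneq kC => ->; rewrite mulr0 ltxx.
have aC : `|a| * `|C| <= `|b| * S.
  have h1 : `|a| * `|C| <= `|a| * (eps * h) by apply: ler_wpM2l.
  have h2 : `|b| * (h / 2) <= `|b| * S by apply: ler_wpM2l.
  have h3 : `|a| * eps <= `|b| / 2.
    have : 0 <= `|b| * eps by rewrite mulr_ge0 // ltW.
    by move: epsK; lra.
  have h4 : `|a| * eps * h <= `|b| / 2 * h by rewrite ler_wpM2r // ltW.
  lra.
have bC : `|b| * `|C| = - (b * C).
  have : k ^+ 2 * (b * C) < 0.
    have -> : k ^+ 2 * (b * C) = (k * b) * (k * C) by ring.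
    by rewrite nmulr_rlt0.
  rewrite pmulr_rlt0 ?exprn_even_gt0 // => bC.
  by rewrite -normrM ltr0_norm.
have nC : 0 < `|C| by rewrite normr_gt0.
(* [q] will be the barycentre of [x], [a1], [a2] with weights 1, [w1], [w2]; the normal and
   tangential equations are solved by [w1 + w2 = m] and [w2 - w1 = n']. *)
pose m := `|b| / `|C|; pose n' := a / S.
have m0 : 0 < m by rewrite divr_gt0.
have mC : m * C = - b.
  apply: (mulfI (x := C)) => //; rewrite /m.
  have -> : C * (`|b| / `|C| * C) = `|b| * `|C|.
    have -> : C * (`|b| / `|C| * C) = `|b| / `|C| * `|C| ^+ 2.
      by rewrite real_normK ?num_real //; ring.
    by field; rewrite gt_eqF.
  by rewrite bC; ring.
have nS : n' * S = a by rewrite divfK // gt_eqF.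
have nm : `|n'| <= m.
  by rewrite /n' /m normrM normfV (gtr0_norm Sp) ler_pdivrMr // mulrAC ler_pdivlMr.
pose w1 := (m - n') / 2; pose w2 := (m + n') / 2.
have w10 : 0 <= w1 by rewrite /w1; move: nm; rewrite ler_norml; lra.
have w20 : 0 <= w2 by rewrite /w2; move: nm; rewrite ler_norml; lra.
pose a1 := arc_point A (s + h); pose a2 := arc_point A (s + - h).
have a1E : a1 = q + S *: T + C *: N by rewrite /a1 arc_point_expand.
have a2E : a2 = q - S *: T + C *: N.
  rewrite /a2 arc_point_expand -/k -/T -/N -/q.
  have -> : arc_sin k (- h) = - S.
    by rewrite /S /arc_sin (negbTE k0) mulrN sinN mulNr.
  have -> : arc_cos k (- h) = C by rewrite /C /arc_cos (negbTE k0) mulrN cosN.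
  by rewrite scaleNr.
have xE : x = q + a *: T + b *: N.
  by rewrite -addrA -frame_decomp addrC subrK.
(* The barycentre is formed in two steps, each joining a point of [F] to a point of its closure. *)
have g1 : F (a1 + (1 / (1 + w1)) *: (x - a1)).
  apply: convex_closure_open => //.
  by apply: convex_weight => //; rewrite ltr_wpDr.
have g2 : F (a2 + ((1 + w1) / (1 + w1 + w2)) *:
    ((a1 + (1 / (1 + w1)) *: (x - a1)) - a2)).
  apply: convex_closure_open => //.
  by apply: convex_weight => //; rewrite ltr_wpDr.
apply: (offE qe); move: g2; congr F.
have W0 : 1 + w1 + w2 != 0 by rewrite gt_eqF // !ltr_wpDr.
have hT : a + w1 * S - w2 * S = 0 by rewrite /w1 /w2 -nS; field.
have hN : b + w1 * C + w2 * C = 0.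
  by have -> : b + w1 * C + w2 * C = b + m * C by [rewrite /w1 /w2; field]; rewrite mC subrr.
transitivity (q + ((a + w1 * S - w2 * S) / (1 + w1 + w2)) *: T +
   ((b + w1 * C + w2 * C) / (1 + w1 + w2)) *: N); last first.
  by rewrite hT hN !mul0r !scale0r !addr0.
have W1 : 1 + w1 != 0 by rewrite gt_eqF // ltr_wpDr.
by rewrite a1E a2E xE; apply: pointP; rewrite /= /GRing.scale /=; field;
  rewrite W0 W1.
Qed.

(** Through a straight edge, a short orthogonal segment would lead from the exterior into [F], and
    its crossing sum [P] would be zero. *)
Lemma exterior_edge_curved : curve e 0 \in verts B -> bounds e (region B None) ->
  arc_curv A != 0.
Proof.
move=> v0 eX; apply/negP => /eqP k0.
have [l0 _ imA _] := eA.
have ptE s t : arc_point A (s + t) = arc_point A s + t *: arc_tangent A s.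
  by rewrite arc_point_expand /arc_sin /arc_cos k0 eqxx scale0r addr0.
have fin : finite_set [set s | 0 < s < arc_len A /\ arc_point A s \in verts B].
  by have [_ hk _ _] := eA; apply: (arc_preimage_finite hk (finite_seq (verts B))).
have [s hs nvs] := finite_itv_notin l0 fin.
have nv : arc_point A s \notin verts B by apply/negP => h; apply: nvs.
set q := arc_point A s in nv ptE; pose T := arc_tangent A s; pose N := arc_normal A s.
have eq_ : edge_set e q by apply: onE; lra.
have lineE t : - s <= t <= arc_len A - s -> edge_set e (q + t *: T).
  by move=> ht; rewrite -ptE; apply: onE; lra.
have inline x : edge_set e x -> exists t, x = q + t *: T.
  rewrite imA => -[t _ <-]; exists (t - s); rewrite -ptE; congr arc_point; lra.
(* As [q] is no vertex, it is off the closed union of the other edges, so near [q] the graph is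
   contained in the line of [e]. *)
have [eps eps0 heps] : exists2 eps : R, 0 < eps & forall x,
    `|x.1 - q.1| < eps -> `|x.2 - q.2| < eps -> support B x -> edge_set e x.
  pose others := \bigcup_(e' in [set e' : edge B | e' != e]) edge_set e'.
  have co : closed others.
    apply: closed_bigcup => [|e' _]; last exact: edge_set_closed.
    exact: finite_finset.
  have nq : (~` others) q.
    case=> e' /= ee' [t' ht' hq]; case: eq_ => t ht hqt.
    rewrite /= !in_itv /= in ht ht'.
    move/negP: nv; apply; rewrite -hqt.
    have ne : e != e' by rewrite eq_sym.
    by apply: (curve_disjoint ne ht ht'); rewrite hqt.
  have [eps eps0 h] := open_boxP (closed_openC co) nq.
  exists eps => // x h1 h2 [e' he']; have [<-//|ee'] := eqVneq e' e.
  by exfalso; apply: (h x h1 h2); exists e'.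
have TN (x : R * R) (a b : R) : x = q + a *: T + b *: N ->
    dot (x - q) T = a /\ dot (x - q) N = b.
  move=> ->; have -> : q + a *: T + b *: N - q = a *: T + b *: N.
    by apply: pointP; rewrite /= /GRing.scale /=; ring.
  rewrite !dotDl !dotZl (dot_tangent A s) (dot_normal A s) (dotC N T).
  by rewrite (dot_tangent_normal A s) !mulr0 !mulr1 addr0 add0r.
have dec x : x = q + dot (x - q) T *: T + dot (x - q) N *: N.
  by rewrite -addrA -frame_decomp addrC subrK.
set a := dot (f - q) T; set b := dot (f - q) N.
have fE : f = q + a *: T + b *: N := dec f.
pose eta := Num.min s (arc_len A - s); have eta0 : 0 < eta by rewrite lt_min; lra.
have lineN t : `|t| < eta -> edge_set e (q + t *: T).
  by rewrite lt_min !ltr_norml => ht; apply: lineE; lra.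
have lineC t : `|t| < eta -> closure F (q + t *: T) by move=> /lineN /eF.
(* If [f] were on this line, [q] would lie between [f] and a point of the edge, hence in [F]. *)
have b0 : b != 0.
  apply/eqP => b0; rewrite b0 scale0r addr0 in fE.
  have a0 : a != 0.
    by apply/eqP => a0; apply: (offE eq_); rewrite a0 scale0r addr0 in fE; rewrite -fE.
  have na : 0 < `|a| by rewrite normr_gt0.
  pose h := eta / 2; have h0 : 0 < h by rewrite divr_gt0.
  have cy : closure F (q + (- Num.sg a * h) *: T).
    by apply: lineC; rewrite normrM normrN normr_sg a0 mul1r gtr0_norm // /h; lra.
  apply: (offE eq_).
  have -> : q = (q + (- Num.sg a * h) *: T) +
      (h / (h + `|a|)) *: (f - (q + (- Num.sg a * h) *: T)).
    have fE' : f = q + (Num.sg a * `|a|) *: T by rewrite -numEsg.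
    rewrite fE'.
    by apply: pointP; rewrite /= /GRing.scale /=; field; lra.
  apply: convex_closure_open => //.
  by rewrite divr_gt0 ?addr_gt0 //= ler_pdivrMr ?addr_gt0 // mul1r; lra.
have nb : 0 < `|b| by rewrite normr_gt0.
pose g := Num.sg b; have hg : g = 1 \/ g = -1 by exact: sgr_pm1.
have gg : g * g = 1 by case: hg => ->; ring.
have gb : g * b = `|b| by rewrite normrEsg.
have bg : b = g * `|b| by exact: numEsg.
pose K := 4 * (1 + `|a| / `|b|).
have K0 : 0 < K by rewrite mulr_gt0 // ltr_pwDl // divr_ge0.
pose del := Num.min (`|b| / 2) (eta / K).
have del0 : 0 < del by rewrite lt_min !divr_gt0.
(* Each point of this half-box lies between a point [q + z *: T] of the edge and [f]. *)
have sideF (x y : R) : `|x| < del -> 0 < y < del -> F (q + x *: T + (y * g) *: N).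
  rewrite !lt_min => /andP[xb xe] /andP[y0 /andP[yb ye]].
  pose t := y / `|b|; have t0 : 0 < t by rewrite divr_gt0.
  have tb : t * `|b| = y by rewrite divfK // gt_eqF.
  have t2 : t <= 1 / 2 by rewrite ler_pdivrMr //; lra.
  pose z := (x - t * a) / (1 - t).
  have zb : `|z| < eta.
    rewrite /z normrM normfV (gtr0_norm (x := 1 - t)); last lra.
    rewrite ltr_pdivrMr; last lra.
    apply: (@lt_le_trans _ _ (eta / 2)); last first.
      by rewrite ler_pM2l //; lra.
    apply: le_lt_trans (ler_normB _ _) _; rewrite (normrM t) (gtr0_norm t0).
    have ta : t * `|a| = y * (`|a| / `|b|) by rewrite /t mulrAC mulrA.
    move: xe ye; rewrite !ltr_pdivlMr // ta /K => xe ye.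
    have p1 : 0 <= `|a| / `|b| by rewrite divr_ge0.
    have p2 : 0 <= `|x| * (`|a| / `|b|) by rewrite mulr_ge0.
    have p3 : 0 <= y * (`|a| / `|b|) by rewrite mulr_ge0 // ltW.
    lra.
  have -> : q + x *: T + (y * g) *: N = (q + z *: T) + t *: (f - (q + z *: T)).
    have hz : z * (1 - t) = x - t * a by rewrite divfK //; lra.
    transitivity (q + (z * (1 - t) + t * a) *: T + (t * b) *: N).
      by rewrite hz subrK bg -tb; congr (_ + _ *: N); ring.
    by rewrite fE; apply: pointP; rewrite /= /GRing.scale /=; ring.
  by apply: convex_closure_open => //; [exact: lineC | lra].
pose r := Num.min (del / 2) (eps / 4).
have r0 : 0 < r by rewrite lt_min !divr_gt0.
have [x Nx [x1 x2]] := (closure_boxP _ q).1 (eX _ eq_) _ r0.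
set xa := dot (x - q) T; set xb := dot (x - q) N.
have xE : x = q + xa *: T + xb *: N := dec x.
have rdel : 2 * r <= del by rewrite mulrC -ler_pdivlMr // ge_min lexx.
have reps : 2 * (2 * r) <= eps.
  by rewrite mulrA -natrM mulrC -ler_pdivlMr // ge_min lexx orbT.
have bnd (y z c d : R) : `|y| < r -> `|z| < r -> `|c| <= 1 -> `|d| <= 1 ->
    `|y * c + z * d| < 2 * r.
  move=> hy hz hc hd; apply: le_lt_trans (ler_normD _ _) _; rewrite !normrM.
  by apply: lt_add_double; [apply: le_lt_trans hy | apply: le_lt_trans hz];
    rewrite ler_piMr.
have xa2 : `|xa| < 2 * r by apply: bnd; rewrite ?cos_max ?sin_max.
have xb2 : `|xb| < 2 * r by apply: bnd; rewrite ?normrN ?cos_max ?sin_max.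
have near_q (y z : R) : `|y| <= 2 * r -> `|z| <= 2 * r -> `|y| + `|z| < 2 * (2 * r) ->
    support B (q + y *: T + z *: N) -> edge_set e (q + y *: T + z *: N).
  have cancel_l (c1 c2 c3 : R) : c1 + c2 + c3 - c1 = c2 + c3 by ring.
  move=> hy hz hyz; apply: heps; rewrite /= /GRing.scale /= cancel_l;
    apply: le_lt_trans (ler_normD _ _) _; apply: le_add_lt (lt_le_trans hyz reps);
    by rewrite normrM ler_piMr // ?normrN ?cos_max ?sin_max.
have offline (y z : R) : `|y| <= 2 * r -> `|z| <= 2 * r ->
    `|y| + `|z| < 2 * (2 * r) ->
    support B (q + y *: T + z *: N) -> z = 0.
  move=> hy hz hyz /(near_q _ _ hy hz hyz) /inline[t ht].
  have [_ <-] := TN _ y z erefl.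
  by have [_ <-] := TN _ t 0 ltac:(by rewrite scale0r addr0); rewrite ht.
(* The exterior point [x] is neither on the edge nor in [F], so it is on the side opposite to
   [f]. *)
have xbg : g * xb < 0.
  rewrite ltNge le_eqVlt; apply/negP => /orP[/eqP xb0|xb0].
    have xz : xb = 0 by rewrite -[xb]mul1r -gg -mulrA -xb0 mulr0.
    have : edge_set e x.
      rewrite xE xz scale0r addr0; apply: lineN.
      apply: lt_le_trans xa2 _; apply: le_trans rdel _.
      rewrite ge_min; apply/orP; right; rewrite ler_pdivrMr // ler_peMr ?(ltW eta0) //.
      by rewrite (@le_trans _ _ 4) ?ler1n // ler_peMr // lerDl divr_ge0.
    by move=> ex; apply: (region_support Nx); exists e.
  have : F x.
    have -> : x = q + xa *: T + ((g * xb) * g) *: N.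
      by rewrite {1}xE mulrAC gg mul1r.
    apply: sideF; first exact: lt_le_trans xa2 rdel.
    rewrite xb0 /=; apply: le_lt_trans (lt_le_trans xb2 rdel); have : g * xb <= `|xb|.
      by case: hg => ->; [rewrite mul1r | rewrite mulN1r -normrN]; exact: ler_norm.
    exact.
  by move/Fi => h; have := region_inj Nx h.
pose h := `|xb|; have xb0 : xb != 0 by apply: contraTneq xbg => ->; rewrite mulr0 ltxx.
have h0 : 0 < h by rewrite normr_gt0.
have xbE : xb = - h * g.
  have : g * xb = - h.
    by rewrite /h; case: hg xbg => ->; rewrite ?mul1r ?mulN1r ?oppr_lt0 => hx;
       [rewrite ltr0_norm // opprK | rewrite gtr0_norm].
  by move=> <-; rewrite mulrAC gg mul1r.
(* Moving [x] parallel to the edge, off the graph, brings it to the point facing [q]. *)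
have Next : region B None (q - h *: (g *: N)).
  apply: (region_segment Nx) => _ [t t01 ->].
  have -> : x + t *: (q - h *: (g *: N) - x) = q + ((1 - t) * xa) *: T + xb *: N.
    by rewrite xE xbE; apply: pointP; rewrite /= /GRing.scale /=; ring.
  have xat : `|(1 - t) * xa| <= `|xa| by apply: ler_unit_norm; rewrite subr_ge0 gerBl andbC.
  move/offline => hh; move/eqP: xb0; apply; apply: hh.
  - exact: le_trans xat (ltW xa2).
  - exact: ltW.
  - by apply: lt_add_double => //; exact: le_lt_trans xat xa2.
have Nint : region B (Some i) (q + h *: (g *: N)).
  apply: Fi; have := @sideF 0 h; rewrite normr0 scale0r addr0 scalerA.
  by apply; rewrite ?h0 //=; apply: lt_le_trans xb2 _.
have := exterior_crossing pressureP eA hs h0 (v := g *: N) (i := i).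
rewrite dotZl dot_normal mulr1 k0 mulr0 => hc.
suff : P = 0 by move=> P0; move: P_gt0; rewrite P0 ltxx.
apply: hc => //.
  by case: hg => ->; rewrite ?oppr_eq0 oner_eq0.
move=> t ht; have -> : arc_point A s + t *: (g *: N) = q + 0 *: T + (t * g) *: N.
  by rewrite scale0r addr0 scalerA.
have th : `|t| <= h by rewrite ler_norml.
have tg : `|t * g| = `|t| by rewrite normrM; case: hg => ->; rewrite ?normrN normr1 mulr1.
have r20 : 0 < 2 * r by rewrite mulr_gt0.
move/offline; rewrite normr0 tg => hh.
have : t * g = 0.
  apply: hh; [exact: ltW | exact: le_trans th (ltW xb2) |].
  by apply: lt_add_double => //; exact: le_lt_trans th xb2.
by move/eqP; rewrite mulf_eq0 => /orP[/eqP//|]; case: hg => ->; rewrite ?oppr_eq0 oner_eq0.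
Qed.

End ExteriorEdge.

(** * Counting *)

Section Generic.
Variable R : realType.
Implicit Types (D E u : R * R) (A : arc R).

Lemma not_hexgeneric u D : ~ hexgeneric u D ->
  [\/ dot u D = 0, dot u (rot120 D) = 0 | dot u (rot120 (rot120 D)) = 0].
Proof.
rewrite /hexgeneric => h; have [h1|h1] := eqVneq (dot u D) 0; first exact: Or31.
have [h2|h2] := eqVneq (dot u (rot120 D)) 0; first exact: Or32.
by have [h3|h3] := eqVneq (dot u (rot120 (rot120 D))) 0; [exact: Or33 | case: h].
Qed.

Lemma finite_not_hexgeneric (T : Type) (X : set T) (u : T -> R * R) D : D != 0 ->
  (forall E, E != 0 -> finite_set [set t | X t /\ dot (u t) E = 0]) ->
  finite_set [set t | X t /\ ~ hexgeneric (u t) D].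
Proof.
move=> D0 hE; apply: (@sub_finite_set _ _ ([set t | X t /\ dot (u t) D = 0] `|`
   [set t | X t /\ dot (u t) (rot120 D) = 0] `|`
   [set t | X t /\ dot (u t) (rot120 (rot120 D)) = 0])).
  move=> t [Xt /not_hexgeneric[] h]; [left; left | left; right | right]; by split.
by rewrite !finite_setU; split; [split|]; apply: hE; rewrite ?rot_eq0.
Qed.

Lemma finite_slope_orthogonal E : E != 0 ->
  finite_set [set m : R | True /\ dot (1, m) E = 0].
Proof.
move=> E0; apply: (@sub_finite_set _ _ [set m | 0 * m ^+ 2 + E.2 * m + E.1 = 0]).
  by move=> m [_]; rewrite /dot /=; lra.
apply: quad_finite; rewrite eqxx /= -negb_and; apply: contraNN E0.
by move=> /andP[/eqP h2 /eqP h1]; apply/eqP; exact: pointP.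
Qed.

(** Two normals orthogonal to [E] are equal or opposite, so only two antipodal points of the circle
    are concerned. *)
Lemma finite_normal_orthogonal A E : arc_curv A != 0 ->
  `|arc_curv A| * arc_len A <= 2 * pi -> E != 0 ->
  finite_set [set s | 0 < s < arc_len A /\ dot (arc_normal A s) E = 0].
Proof.
move=> k0 hk E0.
have [[s1 h1]|none] := pselect (exists s, dot (arc_normal A s) E = 0); last first.
  by apply: (@sub_finite_set _ _ set0) => // s [_ hs]; apply: none; exists s.
pose N1 := arc_normal A s1; pose c := arc_center A.
apply: (@sub_finite_set _ _ [set s | 0 < s < arc_len A /\
  [set c - (arc_curv A)^-1 *: N1; c + (arc_curv A)^-1 *: N1] (arc_point A s)]);
  last by apply: arc_preimage_finite.
move=> s [hs hsE]; split=> //.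
have cr : cross (arc_normal A s) N1 = 0.
  by apply/eqP/negPn/negP => h; move/eqP: E0; apply; exact: dot_vanish h hsE h1.
have NE : arc_normal A s = dot (arc_normal A s) N1 *: N1.
  rewrite [LHS](frame_decomp A s1) (_ : dot _ (arc_tangent A s1) = 0) ?scale0r ?add0r //.
  by rewrite -cr /N1 /cross /dot /=; ring.
have : (dot (arc_normal A s) N1 - 1) * (dot (arc_normal A s) N1 + 1) = 0.
  have h : dot (arc_normal A s) N1 * dot (arc_normal A s) N1 = 1.
    by rewrite -dotZr -NE dot_normal.
  move: h; set z := dot _ _ => h.
  by have -> : (z - 1) * (z + 1) = z * z - 1 by [ring]; rewrite h subrr.
move/eqP; rewrite mulf_eq0 subr_eq0 addr_eq0 => /orP[] /eqP hN.
  by left; rewrite /= arc_point_center // NE hN scale1r.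
by right; rewrite /= arc_point_center // NE hN scaleN1r scalerN opprK.
Qed.

End Generic.

Section Counting.
Variables (R : realType) (n : nat) (B : bubble_complex R n).
Hypothesis Breg : regular B.
Variable P : R.
Hypothesis P_gt0 : 0 < P.
Hypothesis pressureP : forall i : 'I_n, crossing_sum B (Some i) = [set P].

Lemma card_face_edges (i : 'I_n) x : region B (Some i) x ->
  let F := connected_component (region B (Some i)) x in
  let k := #|[pred e : edge B | `[< bounds e F >]]| in
  (k <= 6)%N /\ (shares_edge_with_exterior B F -> (k <= 5)%N).
Proof.
move=> ix F k.
have Fx : F x by exact: connected_component_refl.
have oF : open F by apply: component_open; exact: region_open.
have cF : segment_convex F := face_convex Breg P_gt0 pressureP (i := i) (x0 := x).
have Fi y : F y -> region B (Some i) y by exact: connected_component_sub.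
have offS y : support B y -> ~ F y by move=> hy /Fi /region_support.
have [[e [be nv]]|hv] := pselect (exists e : edge B, bounds e F /\ curve e 0 \notin verts B).
  have k1 : (k <= 1)%N.
    rewrite -(card1 e); apply: subset_leq_card; apply/fintype.subsetP => e'.
    rewrite !inE => /asboolP /asboolP be'; apply/eqP.
    exact: (closed_edge_alone Breg oF cF Fx offS nv be be').
  by split=> [|_]; exact: leq_trans k1 _.
have ev (e : edge B) : bounds e F -> curve e 0 \in verts B.
  by move=> be; apply/negPn/negP => nv; apply: hv; exists e.
pose V := undup [seq v <- verts B | `[< closure F v >]].
have uV : uniq V by exact: undup_uniq.
have memV v : v \in V -> v \in verts B /\ closure F v.
  by rewrite mem_undup mem_filter => /andP[/asboolP].
(* Double counting: [2 * k] edge-ends bound [F], and each vertex in its closure carries at most two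
   of them. *)
have kV : (k <= size V)%N.
  have := @card_fibers _ _ (@edge_end R B) V 2 [pred d | `[< bounds d.1 F >]].
  rewrite (_ : #|[pred d : edge B * bool | `[< bounds d.1 F >]]| = 2 * k)%N; last first.
    rewrite mulnC -card_bool -cardX; apply: eq_card => d.
    by rewrite !inE andbT.
  rewrite leq_pmul2l // => h; apply: h => [d /asboolP bd|v /memV[vB cv]].
    rewrite mem_undup mem_filter; apply/andP; split.
      apply/asboolP; apply: bd; exists (d.2)%:R => //=.
      by rewrite in_itv /=; case: (d.2); rewrite /= ?ler01 ?lexx.
    have v0 := ev _ bd; rewrite /edge_end; case: (d.2) => //=.
    by case: (curve_ends d.1) => [[]//|[_]]; rewrite v0.
  exact: (face_corner Breg oF cF Fx offS vB cv).2.
have /choice[Dir hDir] : forall v, exists D, v \in V ->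
    dot D D = 1 /\ corner (closure F) v D.
  move=> v; have [/memV[vB cv]|_] := boolP (v \in V); last by exists 0.
  by have [[D D1 cD] _] := face_corner Breg oF cF Fx offS vB cv; exists D.
have Dir0 v : v \in V -> Dir v != 0.
  move=> /hDir[h _]; apply/eqP => h0; move: h; rewrite h0 /dot /=; lra.
have badV (T : choiceType) (X : set T) (u : T -> R * R) :
    (forall E, E != 0 -> finite_set [set t | X t /\ dot (u t) E = 0]) ->
    finite_set [set t | X t /\ exists2 v, v \in V & ~ hexgeneric (u t) (Dir v)].
  move=> hE; apply: (@sub_finite_set _ _ (\bigcup_(v in [set` V])
      [set t | X t /\ ~ hexgeneric (u t) (Dir v)])).
    by move=> t [Xt [v vV hv']]; exists v.
  apply: bigcup_finite => [|v /= vV]; first exact: finite_seq.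
  by apply: finite_not_hexgeneric => //; exact: Dir0.
have count u : (forall v, v \in V -> hexgeneric u (Dir v)) -> (size V <= 6)%N /\
    (forall q, closure F q -> q \notin V ->
       (forall x, closure F x -> dot u x <= dot u q) -> (size V <= 5)%N).
  move=> hu; apply: (@corner_count _ (closure F) V Dir u uV) => v vV.
  by have [_ cv] := memV _ vV; have [_ cD] := hDir _ vV; split=> //; exact: hu.
split.
  have [m _ hm] := finite_itv_notin (@ltr01 R)
    (badV _ _ (fun m => (1, m)) (@finite_slope_orthogonal R)).
  apply: leq_trans kV _; apply: (count (1, m) _).1 => v vV.
  by apply: contrapT => h; apply: hm; split=> //; exists v.
case=> e [be bX]; have v0 := ev _ be.
have [A eA] := regular_curvature Breg e; have [l0 hk imA _] := eA.
have k0 := exterior_edge_curved P_gt0 pressureP oF cF Fx Fi eA be v0 bX.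
(* A multiple of the outward normal: by [arc_support_line], [dot (u s)] is maximal on the closure of
   [F] at [arc_point A s]. *)
pose u s := (- arc_curv A) *: arc_normal A s.
(* The parameter must make the six directions generic for every corner, and its point must not be a
   corner itself. *)
have bad : finite_set ([set s | 0 < s < arc_len A /\
      exists2 v, v \in V & ~ hexgeneric (u s) (Dir v)] `|`
    [set s | 0 < s < arc_len A /\ [set` V] (arc_point A s)]).
  rewrite finite_setU; split; last exact: (arc_preimage_finite hk (finite_seq V)).
  apply: badV => E E0; apply: sub_finite_set (finite_normal_orthogonal k0 hk E0).
  move=> s [hs]; rewrite /u dotZl => /eqP.
  by rewrite mulf_eq0 oppr_eq0 (negbTE k0) => /eqP h; split.
have [s hs nbad] := finite_itv_notin l0 bad.
apply: leq_trans kV _.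
have gen v : v \in V -> hexgeneric (u s) (Dir v).
  by move=> vV; apply: contrapT => h; apply: nbad; left; split=> //; exists v.
apply: (count (u s) gen).2 (arc_point A s) _ _ _.
- by apply: be; rewrite imA; exists s => //=; rewrite in_itv /=; lra.
- by apply/negP => h; apply: nbad; right.
- move=> y cy; apply: (@lin_closure _ _ (dot (u s) x)) => t ht.
  have := arc_support_line oF cF Fi eA be k0 hs (convex_closure_open oF cF Fx cy ht).
  set z := dot _ _ => z0.
  have -> : dot (u s) y + t * (dot (u s) x - dot (u s) y) =
      dot (u s) (arc_point A s) - arc_curv A * z.
    by rewrite /z /u /dot /= /GRing.scale /=; ring.
  by rewrite lerBlDr lerDl.
Qed.

End Counting.

Theorem lemma4p1 (R : realType) (n : nat) (B : bubble_complex R n)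
    (Breg : regular B)
    (Bchambers : ~ exists C, empty_chamber B C)
    (Bpressure : positive_equal_pressure B) :
  forall (k : nat) (F : set (R * R)), kgon B k F ->
    (k <= 6)%N /\ (shares_edge_with_exterior B F -> (k <= 5)%N).
Proof.
move=> k F [[i [x [ix ->]]] <-]; have [P P_gt0 pressureP] := Bpressure.
exact: (card_face_edges Breg P_gt0 pressureP ix).
Qed.
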